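(* For every $n\ge2$, every $t\in\mathbb C^\times$ and every $1\le m\le8$, the representation of the braid group $\mathcal B_n$ on $(\mathbb C^8)^{\otimes n}$ generated by $\widehat R_{m,t}=R(C_m(t))/\sqrt8$ has virtually abelian image. Precisely, if $\Gamma_n$ denotes its image, then $$\Gamma_n\cap(\mathcal H^{\mathrm{mat}}_{n-1})^\times$$ is an abelian normal subgroup of $\Gamma_n$ of finite index. The same conclusion holds for the representation generated by the unnormalized operator $R(C_m(t))$. The normalized generator $\widehat R_{m,t}$ is unitary when $|t|=1$.
   Context: Let $w=e^{2\pi\mathrm i/8}$. On $\mathbb C^8$ with orthonormal basis $e_j$, $j\in\mathbb Z/8\mathbb Z$, let $Xe_j=e_{j+1}$, $Ze_j=w^je_j$. For $\mathbf a=[a_0,\dots,a_7]\in\mathbb C^8$ put $R(\mathbf a)=\sum_{k=0}^7a_k(X\otimes Z)^k$. Set $I_{\alpha,\eta}(t)=[1,\alpha t,\eta,t,-1,\alpha t,-\eta,t]$, $II_{\delta,\beta}(t)=[1,\delta t,\beta,-t,1,-\delta t,\beta,t]$, and $$C_1=I_{-\mathrm i,-1},\ C_2=I_{-\mathrm i,1},\ C_3=I_{\mathrm i,-1},\ C_4=I_{\mathrm i,1},\ C_5=II_{-1,-\mathrm i},\ C_6=II_{-1,\mathrm i},\ C_7=II_{1,-\mathrm i},\ C_8=II_{1,\mathrm i}.$$ For $t\ne0$ the operators $R(C_m(t))$ are invertible Yang--Baxter operators; an invertible Yang--Baxter operator $R$ on $\mathbb C^8$ gives the representation $\sigma_i\mapsto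 I^{\otimes(i-1)}\otimes R\otimes I^{\otimes(n-i-1)}$ of $\mathcal B_n$ ($\sigma_i$ the Artin generators). $\mathcal H^{\mathrm{mat}}_{n-1}\subset\mathrm{End}((\mathbb C^8)^{\otimes n})$ is the (commutative) unital subalgebra generated by $J_i=(X_iZ_{i+1})^4$, $1\le i<n$, where subscripts on $X$, $Z$ indicate the tensor factor; $(\mathcal H^{\mathrm{mat}}_{n-1})^\times$ is its group of units. *)

(* Defs.v *)
From HB Require Import structures.
From mathcomp Require Import all_boot all_order all_algebra.
From mathcomp Require Import boolp classical_sets functions cardinality.
From mathcomp Require Import generic_quotient reals trigo complex mxtens.

Set Implicit Arguments.
Unset Strict Implicit.
Unset Printing Implicit Defensive.

Import Order.TTheory GRing.Theory Num.Theory.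

Local Open Scope quotient_scope.
Local Open Scope classical_set_scope.
Local Open Scope ring_scope.

Section AbstractGroups.
Variable G : groupType.
Local Open Scope group_scope.

Definition subgroup (A : set G) : Prop :=
  [/\ A 1, forall x y, A x -> A y -> A (x * y) & forall x, A x -> A x^-1].

Definition abelian_set (A : set G) : Prop :=
  forall x y, A x -> A y -> x * y = y * x.

Definition normal_in (A B : set G) : Prop :=
  [/\ subgroup A, A `<=` B & forall b x, B b -> A x -> A (b * x * b^-1)].

(* Finitely many left cosets of A by elements of B. *)
Definition finite_index_in (A B : set G) : Prop :=
  finite_set [set [set b * x | x in A] | b in B].

Definition virtually_abelian (B : set G) : Prop :=
  exists A, [/\ subgroup A, A `<=` B, abelian_set A & finite_index_in A B].

End AbstractGroups.

Section GeneralLinearGroup.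
Variables (F : comUnitRingType) (d : nat).

Definition glmx : predArgType := {A : 'M[F]_d | A \in unitmx}.
HB.instance Definition _ := SubChoice.on glmx.

Fact glmx1_subproof : (1%:M : 'M[F]_d) \in unitmx.
Proof. exact: unitmx1. Qed.
Fact glmxM_subproof (A B : glmx) : (val A *m val B) \in unitmx.
Proof. by rewrite unitmx_mul (valP A) (valP B). Qed.
Fact glmxV_subproof (A : glmx) : invmx (val A) \in unitmx.
Proof. by rewrite unitmx_inv (valP A). Qed.

Definition glmx1 : glmx := Sub 1%:M glmx1_subproof.
Definition glmxM (A B : glmx) : glmx := Sub (val A *m val B) (glmxM_subproof A B).
Definition glmxV (A : glmx) : glmx := Sub (invmx (val A)) (glmxV_subproof A).

Fact glmxA : associative glmxM.
Proof. by move=> A B C; apply: val_inj; rewrite /= mulmxA. Qed.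
Fact glmx1M : left_id glmx1 glmxM.
Proof. by move=> A; apply: val_inj; rewrite /= mul1mx. Qed.
Fact glmxM1 : right_id glmx1 glmxM.
Proof. by move=> A; apply: val_inj; rewrite /= mulmx1. Qed.
Fact glmxVM : left_inverse glmx1 glmxV glmxM.
Proof. by move=> A; apply: val_inj; rewrite /= mulVmx ?(valP A). Qed.
Fact glmxMV : right_inverse glmx1 glmxV glmxM.
Proof. by move=> A; apply: val_inj; rewrite /= mulmxV ?(valP A). Qed.

HB.instance Definition _ :=
  isGroup.Build glmx glmxA glmx1M glmxM1 glmxVM glmxMV.

Definition unital_subalgebra (S : set 'M[F]_d) : Prop :=
  [/\ S 1%:M, forall a x y, S x -> S y -> S (a *: x + y)
    & forall x y, S x -> S y -> S (x *m y)].

Definition generated_subalgebra (S : set 'M[F]_d) : set 'M[F]_d :=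
  smallest unital_subalgebra S.

Definition subalgebra_units (S : set 'M[F]_d) : set glmx :=
  [set g : glmx | S (val g) /\ S (val (g^-1 : glmx)%g)].

End GeneralLinearGroup.

(* The braid group on n strands, by Artin's presentation. The generators are   *)
(* numbered from 0, and the letter (i, b) stands for sigma_i if b = true and   *)
(* for its inverse if b = false.                                               *)
Section BraidGroup.
Variable n : nat.

Definition braid_word : Type := seq ('I_n.-1 * bool).

Inductive braid_rel : braid_word -> braid_word -> Prop :=
| BraidRefl u : braid_rel u u
| BraidSym u v : braid_rel u v -> braid_rel v u
| BraidTrans v u w : braid_rel u v -> braid_rel v w -> braid_rel u w
| BraidCat u u' v v' :
    braid_rel u u' -> braid_rel v v' -> braid_rel (u ++ v) (u' ++ v')
| BraidCancel i b : braid_rel [:: (i, b); (i, ~~ b)] [::]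
| BraidYB (i j : 'I_n.-1) : j = i.+1 :> nat ->
    braid_rel [:: (i, true); (j, true); (i, true)]
              [:: (j, true); (i, true); (j, true)]
| BraidFar (i j : 'I_n.-1) : (i.+1 < j)%N ->
    braid_rel [:: (i, true); (j, true)] [:: (j, true); (i, true)].

HB.instance Definition _ := Choice.on braid_word.

Definition braid_relb (u v : braid_word) : bool := `[< braid_rel u v >].

Fact braid_relb_refl : reflexive braid_relb.
Proof. by move=> u; apply/asboolP; exact: BraidRefl. Qed.
Fact braid_relb_sym : symmetric braid_relb.
Proof. by move=> u v; apply/asboolP/asboolP => /BraidSym. Qed.
Fact braid_relb_trans : transitive braid_relb.
Proof.
by move=> v u w /asboolP uv /asboolP vw; apply/asboolP; apply: BraidTrans uv vw.
Qed.

Canonical braid_equiv :=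
  EquivRel braid_relb braid_relb_refl braid_relb_sym braid_relb_trans.

Definition braid : Type := {eq_quot braid_equiv}.
HB.instance Definition _ := Choice.on braid.
HB.instance Definition _ := EqQuotient.on braid.

Definition braid_of (u : braid_word) : braid := \pi_braid u.

Lemma braid_ofP u v : braid_of u = braid_of v <-> braid_rel u v.
Proof. by split => [/eqmodP/asboolP|uv]; last exact/eqmodP/asboolP. Qed.

Lemma braid_of_repr (x : braid) : braid_of (repr x) = x.
Proof. exact: reprK. Qed.

Definition braid_inv_word (u : braid_word) : braid_word :=
  rev [seq (l.1, ~~ l.2) | l <- u].

Lemma braid_cancel u : braid_rel (u ++ braid_inv_word u) [::].
Proof.
elim: u => [|[i b] u IHu]; first exact: BraidRefl.
have -> : ((i, b) :: u) ++ braid_inv_word ((i, b) :: u) =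
    [:: (i, b)] ++ ((u ++ braid_inv_word u) ++ [:: (i, ~~ b)]).
  by rewrite /braid_inv_word /= rev_cons -cats1 !catA.
apply: BraidTrans (BraidCancel i b).
apply: (BraidCat (BraidRefl _)); exact: (BraidCat IHu (BraidRefl _)).
Qed.

Lemma braid_inv_wordK : involutive braid_inv_word.
Proof.
move=> u; rewrite /braid_inv_word map_rev revK -map_comp -[RHS]map_id.
by apply: eq_map => -[i b]; rewrite /= negbK.
Qed.

Lemma braid_cancelV u : braid_rel (braid_inv_word u ++ u) [::].
Proof. by have := braid_cancel (braid_inv_word u); rewrite braid_inv_wordK. Qed.

Definition braid1 : braid := braid_of [::].
Definition braidM (x y : braid) : braid := braid_of (repr x ++ repr y).
Definition braidV (x : braid) : braid := braid_of (braid_inv_word (repr x)).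

Lemma braidM_of u v : braidM (braid_of u) (braid_of v) = braid_of (u ++ v).
Proof. by apply/braid_ofP/BraidCat; apply/braid_ofP; exact: braid_of_repr. Qed.

Fact braidA : associative braidM.
Proof.
move=> x y z.
by rewrite -(braid_of_repr x) -(braid_of_repr y) -(braid_of_repr z) !braidM_of catA.
Qed.
Fact braid1M : left_id braid1 braidM.
Proof. by move=> x; rewrite -(braid_of_repr x) braidM_of. Qed.
Fact braidM1 : right_id braid1 braidM.
Proof. by move=> x; rewrite -(braid_of_repr x) braidM_of cats0. Qed.
Fact braidVM : left_inverse braid1 braidV braidM.
Proof.
move=> x; rewrite -{2}(braid_of_repr x) braidM_of.
exact/braid_ofP/braid_cancelV.
Qed.
Fact braidMV : right_inverse braid1 braidV braidM.
Proof.
move=> x; rewrite -{1}(braid_of_repr x) braidM_of.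
exact/braid_ofP/braid_cancel.
Qed.

HB.instance Definition _ :=
  isGroup.Build braid braidA braid1M braidM1 braidVM braidMV.

Definition sigma (i : 'I_n.-1) : braid := braid_of [:: (i, true)].

End BraidGroup.

(* Operators on (C^8)^{(x) n}, as matrices of size 8 ^ n acting on column      *)
(* vectors; tensor factors are numbered from 0.                                *)
Section TensorPower.
Variables (C : comPzRingType) (n : nat).

Fact dim_on_factor i : (i < n)%N -> (8 ^ i * 8 * 8 ^ (n - i.+1) = 8 ^ n)%N.
Proof. by move=> lt_in; rewrite -expnSr -expnD subnKC. Qed.

Fact dim_on_pair i :
  (i.+1 < n)%N -> (8 ^ i * (8 * 8) * 8 ^ (n - i.+2) = 8 ^ n)%N.
Proof. by move=> lt_in; rewrite mulnA -!expnSr -expnD subnKC. Qed.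

Definition on_factor i (lt_in : (i < n)%N) (A : 'M[C]_8) : 'M[C]_(8 ^ n) :=
  let e := dim_on_factor lt_in in
  castmx (e, e) ((1%:M : 'M_(8 ^ i)) *t A *t (1%:M : 'M_(8 ^ (n - i.+1)))).

Definition on_pair i (lt_in : (i.+1 < n)%N) (A : 'M[C]_(8 * 8)) :
    'M[C]_(8 ^ n) :=
  let e := dim_on_pair lt_in in
  castmx (e, e) ((1%:M : 'M_(8 ^ i)) *t A *t (1%:M : 'M_(8 ^ (n - i.+2)))).

Fact ltn_ord_pred (i : 'I_n.-1) : (i.+1 < n)%N.
Proof. by rewrite -ltn_predRL. Qed.

End TensorPower.

(* rho sends sigma_i to I^{(x) i} (x) A (x) I^{(x) (n - i - 2)}. Such a rho is *)
(* unique, and exists when A is an invertible Yang-Baxter operator.            *)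
Definition is_rep_generated_by (C : comUnitRingType) (n : nat)
    (A : 'M[C]_(8 * 8)) (rho : {multiplicative braid n -> glmx C (8 ^ n)}) :
    Prop :=
  forall i : 'I_n.-1, val (rho (sigma i)) = on_pair (ltn_ord_pred i) A.

Section Operators.
Variable R : realType.
Local Notation C := R[i].
Local Notation i := ('i%C : C).

Definition w : C := (cos (2 * pi / 8) +i* sin (2 * pi / 8))%C.

Definition X : 'M[C]_8 := \matrix_(j, k) (j == k + 1 :> 'Z_8)%:R.
Definition Z : 'M[C]_8 := diag_mx (\row_j w ^+ j).

Definition Rmx (a : 'rV[C]_8) : 'M[C]_(8 * 8) :=
  \sum_(k < 8) a 0 k *: (X *t Z) ^+ k.

Definition typeI (alpha eta t : C) : 'rV[C]_8 :=
  \row_k [:: 1; alpha * t; eta; t; -1; alpha * t; - eta; t]`_k.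
Definition typeII (delta beta t : C) : 'rV[C]_8 :=
  \row_k [:: 1; delta * t; beta; - t; 1; - (delta * t); beta; t]`_k.

(* The vector C_{m+1}(t). *)
Definition Cvec (m : 'I_8) (t : C) : 'rV[C]_8 :=
  [:: typeI (- i) (-1) t; typeI (- i) 1 t; typeI i (-1) t; typeI i 1 t;
      typeII (-1) (- i) t; typeII (-1) i t; typeII 1 (- i) t; typeII 1 i t]`_m.

Definition Rhat (m : 'I_8) (t : C) : 'M[C]_(8 * 8) :=
  (sqrtC 8)^-1 *: Rmx (Cvec m t).

Section Materialised.
Variable n : nat.

Definition J (k : 'I_n.-1) : 'M[C]_(8 ^ n) :=
  (on_factor (ltnW (ltn_ord_pred k)) X *m on_factor (ltn_ord_pred k) Z) ^+ 4.

Definition Hmat : set 'M[C]_(8 ^ n) := generated_subalgebra (range J).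

End Materialised.

End Operators.

Arguments Hmat R n : clear implicits.

(* Main.v *)
From HB Require Import structures.
Require Import Defs.
From mathcomp Require Import all_boot all_order all_algebra.
From mathcomp Require Import boolp classical_sets functions cardinality.
From mathcomp Require Import reals trigo complex mxtens ring lra zify.

(* Put u_k = X_k Z_(k+1), so that u_k^8 = 1, u_k u_(k+1) = w u_(k+1) u_k, and  *)
(* sigma_k acts by a polynomial f_t(u_k). The braid relation and the identities*)
(* below are identities in the quantum torus uv = wvu, checked by computation. *)
(* - f_t(u_k) = d f_1(u_k) with d a unit of span(1, J_k), hence of H = H^mat.  *)
(* - Conjugation by f_1(u_k) sends J_l to +-J_l or +-J_l J_k, so that f_1(u_k) *)
(*   normalizes H; it sends X_(k+1) and Z_k to X_(k+1) u_k^r h and Z_k u_k^s h'*)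
(*   with h, h' in H of order dividing 8, and fixes the other X_j and Z_j.     *)
(* Thus f_1(u_k) normalizes the monoid S generated by the X_j, the Z_j and the *)
(* 8-torsion of H. S is finite: its elements are products of a monomial matrix *)
(* with entries in the 8th roots of unity and an 8-torsion element of H, and H *)
(* is diagonalizable. So the image of the braid group lies in N H^x, where N   *)
(* normalizes H and S, and two elements of N that act alike on the X_j and Z_j *)
(* differ by a scalar, which lies in H^x.                                      *)

(** The mechanism is that of a Clifford group. The even and odd parts of [YBop m t u] live on
    opposite eigenspaces of the involution [u ^+ 4], so the parameter [t] only rescales one
    eigenspace and splits off as a unit of $H$ ([YBop_split]). The remaining operator, at [t = 1],
    is a function on the spectrum of [u] whose successive ratios are eighth roots of unity.
    Conjugation by it therefore changes the $X_j$ and $Z_j$ only by powers of $u_k$ and torsion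
    elements of $H$ ([YBop_conj_u], [YBop_conj_v]): it preserves a finite monoid ([YBop_clifford],
    [finite_clifford]), and it normalizes $H$ ([YBop_normalizes]).

    Hence every element of the image is $sh$ with $h\in H^\times$ and [s] normalizing both $H$ and
    the monoid; such products form a group containing the generators ([affine_subgroup],
    [gen_affine]). The conjugates of the $X_j$ and $Z_j$ by [s] are a finite invariant. Two elements
    with the same invariant have first factors that differ by a matrix commuting with all $X_j$ and
    $Z_j$, which is a scalar ([Pauli_centralizer]), so they lie in one coset of $\Gamma\cap
    H^\times$ ([finite_index_unit_part]). This intersection is abelian because the $J_k$ commute,
    and normal because [s] normalizes $H$.

    Unitarity rests on the identity [YBop_adj], which also gives invertibility for every nonzero
    [t]. *)

Set Implicit Arguments.
Unset Strict Implicit.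
Unset Printing Implicit Defensive.

Import Order.TTheory GRing.Theory Num.Theory.
Local Open Scope classical_set_scope.
Local Open Scope ring_scope.

(* Square matrices of arbitrary size, possibly 0, form a ring but no algebra   *)
(* in the sense of [lalgType].                                                *)
Lemma mulmxZl (F : comPzRingType) N (a : F) (A B : 'M[F]_N) :
  (a *: A) * B = a *: (A * B).
Proof. by rewrite -[LHS]/(_ *m _) -scalemxAl. Qed.

Lemma mulmxZr (F : comPzRingType) N (a : F) (A B : 'M[F]_N) :
  A * (a *: B) = a *: (A * B).
Proof. by rewrite -[LHS]/(_ *m _) -scalemxAr. Qed.

(** * A decision procedure for the quantum torus at an eighth root of unity *)

(* (c, d, a, b) stands for w^c t^d v^a u^b, where u v = w v u. *)
Definition qterm : Type := nat * nat * nat * nat.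

(** The phase [b * a'] comes from moving [u ^+ b] past [v ^+ a']. *)
Definition qmul (x y : qterm) : qterm :=
  let: (c, d, a, b) := x in let: (c', d', a', b') := y in
  (c + c' + b * a', d + d', a + a', b + b')%N.

Definition qnorm (x : qterm) : qterm :=
  let: (c, d, a, b) := x in (c %% 8, d, a %% 8, b %% 8)%N.

Definition qopp (x : qterm) : qterm :=
  let: (c, d, a, b) := x in (c + 4, d, a, b)%N.

Definition qmuls (l l' : seq qterm) : seq qterm :=
  [seq qmul x y | x <- l, y <- l'].

Definition qle (x y : qterm) : bool :=
  let: (c, d, a, b) := x in let: (c', d', a', b') := y in
  ((a < a') || (a == a') && ((b < b') || (b == b') &&
    ((c < c') || (c == c') && (d <= d'))))%N.

(* As 1, w, w^2, w^3 are linearly independent over the rationals, a signed    *)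
(* sum of terms vanishes iff it is, up to order, its own opposite.            *)
Definition qeq (l l' : seq qterm) : bool :=
  let s := [seq qnorm x | x <- l ++ map qopp l'] in
  sort qle s == sort qle [seq qnorm (qopp x) | x <- s].

Section QuantumTorus.
Variables (F : numFieldType) (N : nat) (w t : F) (u v : 'M[F]_N).
Hypotheses (w4 : w ^+ 4 = -1) (u8 : u ^+ 8 = 1) (v8 : v ^+ 8 = 1).
Hypothesis uv : u * v = w *: (v * u).

Definition qteval (x : qterm) : 'M[F]_N :=
  let: (c, d, a, b) := x in (w ^+ c * t ^+ d) *: (v ^+ a * u ^+ b).

Definition qeval (l : seq qterm) : 'M[F]_N := \sum_(x <- l) qteval x.

Lemma exp_swap (b a : nat) : u ^+ b * v ^+ a = w ^+ (b * a) *: (v ^+ a * u ^+ b).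
Proof.
have swap1 c : u ^+ c * v = w ^+ c *: (v * u ^+ c).
  elim: c => [|c IH]; first by rewrite !expr0 mul1r mulr1 scale1r.
  by rewrite !exprSr -mulrA uv mulmxZr !mulrA IH mulmxZl scalerA mulrC.
elim: a => [|a IH]; first by rewrite muln0 !expr0 mul1r mulr1 scale1r.
rewrite !exprSr mulrA IH mulmxZl -[_ * _ * v]mulrA swap1 mulmxZr scalerA.
by rewrite -exprD mulnS addnC mulrA.
Qed.

Lemma qtevalM x y : qteval (qmul x y) = qteval x * qteval y.
Proof.
case: x y => [[[c d] a] b] [[[c' d'] a'] b'] /=.
rewrite mulmxZl mulmxZr scalerA.
have -> : v ^+ a * u ^+ b * (v ^+ a' * u ^+ b') = v ^+ a * (u ^+ b * v ^+ a') * u ^+ b'.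
  by rewrite !mulrA.
rewrite exp_swap mulmxZr mulmxZl scalerA !exprD; congr (_ *: _); last by rewrite !mulrA.
by ring.
Qed.

Lemma qevalM l l' : qeval (qmuls l l') = qeval l * qeval l'.
Proof.
rewrite /qeval /qmuls big_allpairs_dep big_distrl /=.
apply: eq_bigr => x _; rewrite big_distrr /=.
by apply: eq_bigr => y _; rewrite qtevalM.
Qed.

Lemma qeval_cat l l' : qeval (l ++ l') = qeval l + qeval l'.
Proof. exact: big_cat. Qed.

Lemma qteval_opp x : qteval (qopp x) = - qteval x.
Proof. by case: x => [[[c d] a] b] /=; rewrite exprD w4 mulrN1 mulNr scaleNr. Qed.

Lemma qteval_norm x : qteval (qnorm x) = qteval x.
Proof.
have w8 : w ^+ 8 = 1 by rewrite (exprM w 4 2) w4 sqrrN expr1n.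
by case: x => [[[c d] a] b] /=; rewrite !expr_mod.
Qed.

Lemma qeval_opp l : qeval (map qopp l) = - qeval l.
Proof.
by rewrite /qeval big_map -sumrN; apply: eq_bigr => x _; rewrite qteval_opp.
Qed.

Lemma qeval_norm l : qeval (map qnorm l) = qeval l.
Proof. by rewrite /qeval big_map; apply: eq_bigr => x _; rewrite qteval_norm. Qed.

(** A multiset of terms equal to its own opposite has a sum equal to its negative, hence zero in
    characteristic 0. *)
Lemma qeqP l l' : qeq l l' -> qeval l = qeval l'.
Proof.
rewrite /qeq; set s := map _ _ => s_opp.
have es : qeval s = qeval l - qeval l' by rewrite qeval_norm qeval_cat qeval_opp.
apply/eqP; rewrite -subr_eq0 -es.
have: qeval s = - qeval s.
  rewrite -qeval_opp -(qeval_norm (map _ _)) -map_comp.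
  by apply: perm_big; rewrite -(perm_sort qle) (eqP s_opp) perm_sort.
move/eqP; rewrite -subr_eq0 opprK -mulr2n -scaler_nat scaler_eq0.
by rewrite pnatr_eq0.
Qed.

End QuantumTorus.

(* C_m(t) has entries w ^ (wexp m k) * t ^ (odd k). *)
Definition wexp (m : nat) : seq nat :=
  nth [::] [:: [:: 0; 6; 4; 0; 4; 6; 0; 0]; [:: 0; 6; 0; 0; 4; 6; 4; 0];
   [:: 0; 2; 4; 0; 4; 2; 0; 0]; [:: 0; 2; 0; 0; 4; 2; 4; 0];
   [:: 0; 4; 6; 4; 0; 0; 6; 0]; [:: 0; 4; 2; 4; 0; 0; 2; 0];
   [:: 0; 0; 6; 4; 0; 4; 6; 0]; [:: 0; 0; 2; 4; 0; 4; 2; 0]]%N m.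

(* Words for R(C_m(t)), R(C_m(1)) and t R(C_m(t))^*, evaluated at u or at v.  *)
Definition qR_u (m : nat) : seq qterm :=
  [seq (nth 0 (wexp m) k, nat_of_bool (odd k), 0, k) | k <- iota 0 8]%N.
Definition qR_v (m : nat) : seq qterm :=
  [seq (nth 0 (wexp m) k, nat_of_bool (odd k), k, 0) | k <- iota 0 8]%N.
Definition qR1_u (m : nat) : seq qterm :=
  [seq (nth 0 (wexp m) k, 0, 0, k) | k <- iota 0 8]%N.
Definition qR1_v (m : nat) : seq qterm :=
  [seq (nth 0 (wexp m) k, 0, k, 0) | k <- iota 0 8]%N.
Definition qRadj_u (m : nat) : seq qterm :=
  [seq (7 * nth 0 (wexp m) k, nat_of_bool (~~ odd k), 0, 7 * k) | k <- iota 0 8]%N.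

(* 2 hpart (w ^ p) (w ^ q), see below *)
Definition qh_u (p q : nat) : seq qterm :=
  [:: (p, 0, 0, 0); (q, 0, 0, 0); (p, 0, 0, 4); (q + 4, 0, 0, 4)]%N.
Definition qh_v (p q : nat) : seq qterm :=
  [:: (p, 0, 0, 0); (q, 0, 0, 0); (p, 0, 4, 0); (q + 4, 0, 4, 0)]%N.

(* 2 hpart 1 t for b = false, and 2 hpart t 1 for b = true *)
Definition qd_u (b : bool) : seq qterm :=
  [:: (0, 0, 0, 0); (0, 1, 0, 0); (4 * ~~ b, 1, 0, 4); (4 * b, 0, 0, 4)]%N.

Definition q2 : seq qterm := nseq 2 (0, 0, 0, 0)%N.

Lemma qR_YB m : (m < 8)%N ->
  qeq (qmuls (qR_u m) (qmuls (qR_v m) (qR_u m)))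
      (qmuls (qR_v m) (qmuls (qR_u m) (qR_v m))).
Proof.
pose yb m := qeq (qmuls (qR_u m) (qmuls (qR_v m) (qR_u m)))
  (qmuls (qR_v m) (qmuls (qR_u m) (qR_v m))).
have /allP yb8 : all yb (iota 0 8) by vm_compute.
by move=> m8; apply: yb8; rewrite mem_iota.
Qed.

Lemma qR_adj m : (m < 8)%N ->
  qeq (qmuls (qR_u m) (qRadj_u m)) (nseq 8 (0, 1, 0, 0)%N).
Proof. by case: m => [|[|[|[|[|[|[|[|]]]]]]]] // _; vm_compute. Qed.

Lemma qR_split m : (m < 8)%N ->
  qeq (qmuls q2 (qR_u m)) (qmuls (qd_u (m < 4)%N) (qR1_u m)).
Proof. by case: m => [|[|[|[|[|[|[|[|]]]]]]]] // _; vm_compute. Qed.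

Lemma qR_J_u m : (m < 8)%N ->
  qeq (qmuls (qR_u m) [:: (0, 0, 4, 0)%N])
      (qmuls [:: (4 * (m < 4), 0, 4, 4)%N] (qR_u m)).
Proof. by case: m => [|[|[|[|[|[|[|[|]]]]]]]] // _; vm_compute. Qed.

Lemma qR_J_v m : (m < 8)%N ->
  qeq (qmuls (qR_v m) [:: (0, 0, 0, 4)%N])
      (qmuls [:: (4 * (m < 4), 0, 4, 4)%N] (qR_v m)).
Proof. by case: m => [|[|[|[|[|[|[|[|]]]]]]]] // _; vm_compute. Qed.

(* Exponents found by search, for the two conjugation identities below. *)
Definition kpq_u m : nat * nat * nat :=
  nth (0, 0, 0) [:: (1, 0, 7); (7, 2, 7); (7, 6, 7); (1, 0, 3);
    (7, 7, 4); (1, 5, 0); (1, 1, 0); (7, 7, 0)]%N m.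
Definition kpq_v m : nat * nat * nat :=
  nth (0, 0, 0) [:: (7, 2, 1); (1, 0, 5); (1, 0, 1); (7, 6, 1);
    (1, 3, 0); (7, 1, 4); (7, 1, 0); (1, 7, 0)]%N m.

Lemma qR1_conj_u m : (m < 8)%N -> let: (k, p, q) := kpq_u m in
  qeq (qmuls q2 (qmuls (qR1_u m) [:: (0, 0, 1, 0)%N]))
      (qmuls (qmuls [:: (0, 0, 1, k)%N] (qh_u p q)) (qR1_u m)).
Proof. by case: m => [|[|[|[|[|[|[|[|]]]]]]]] // _; vm_compute. Qed.

Lemma qR1_conj_v m : (m < 8)%N -> let: (k, p, q) := kpq_v m in
  qeq (qmuls q2 (qmuls (qR1_v m) [:: (0, 0, 0, 1)%N]))
      (qmuls (qmuls (qmuls [:: (0, 0, 0, 1)%N] [:: (0, 0, k, 0)%N]) (qh_v p q))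
         (qR1_v m)).
Proof. by case: m => [|[|[|[|[|[|[|[|]]]]]]]] // _; vm_compute. Qed.

(** * Functions of an involution *)

Section Halves.
Variables (F : numFieldType) (N : nat).
Implicit Type J : 'M[F]_N.

(* The element of span(1, J) equal to a where J = 1 and to b where J = -1. *)
Definition hpart (a b : F) J : 'M[F]_N :=
  2^-1 *: ((a + b) *: (1 : 'M[F]_N) + (a - b) *: J).

(** Functions on the spectrum of an involution multiply pointwise. *)
Lemma hpartM a b a' b' J : J * J = 1 ->
  hpart a b J * hpart a' b' J = hpart (a * a') (b * b') J.
Proof.
move=> JJ.
have prod (x y x' y' : F) :
    (x *: (1 : 'M[F]_N) + y *: J) * (x' *: (1 : 'M[F]_N) + y' *: J) =
    (x * x' + y * y') *: (1 : 'M[F]_N) + (x * y' + y * x') *: J.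
  rewrite mulrDl !mulrDr !mulmxZl !mulmxZr JJ !mulr1 !mul1r !scalerA.
  by rewrite 2!scalerDl [X in _ + X = _]addrC addrACA.
rewrite /hpart mulmxZl mulmxZr prod scalerA !scalerDr !scalerA.
by congr (_ *: _ + _ *: _); field.
Qed.

Lemma hpart1 J : hpart 1 1 J = 1.
Proof. by rewrite /hpart subrr scale0r addr0 scalerA mulVf ?scale1r // pnatr_eq0. Qed.

Lemma hpartX a b J k : J * J = 1 -> hpart a b J ^+ k = hpart (a ^+ k) (b ^+ k) J.
Proof.
move=> JJ; elim: k => [|k IHk]; first by rewrite !expr0 hpart1.
by rewrite !exprS IHk hpartM.
Qed.

End Halves.

(** * Identities of the Yang-Baxter operators in the quantum torus *)

Section YangBaxter.
Variables (F : numFieldType) (N : nat) (w : F).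
Hypothesis w4 : w ^+ 4 = -1.

(** The polynomial $f_t$ of the outline, with [m] counted from 0: it gives $R(C_{m+1}(t))$ at
    $u=X\otimes Z$ ([Rmx_YBop]) and, up to a scalar, the image of a braid generator at [uop k]. *)
Definition YBop (m : nat) (t : F) (u : 'M[F]_N) : 'M[F]_N :=
  \sum_(k < 8) (w ^+ nth 0%N (wexp m) k * t ^+ odd k) *: u ^+ k.

Lemma YBopE (m : nat) (t : F) (u : 'M[F]_N) : YBop m t u =
  \sum_(k < 8) (w ^+ nth 0%N (wexp m) k * t ^+ odd k) *: u ^+ k.
Proof. by []. Qed.

Lemma YBop_comm (m : nat) (t : F) (A u : 'M[F]_N) :
  A * u = u * A -> A * YBop m t u = YBop m t u * A.
Proof.
move=> Au; rewrite /YBop big_distrr big_distrl /=; apply: eq_bigr => j _.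
by rewrite mulmxZl mulmxZr; congr (_ *: _); exact: commrX.
Qed.

Variables (t : F) (u v : 'M[F]_N) (m : nat).
Hypotheses (u8 : u ^+ 8 = 1) (v8 : v ^+ 8 = 1) (uv : u * v = w *: (v * u)).
Hypothesis m8 : (m < 8)%N.
Let ev := qeval w t u v.

Let eqP8 l l' : qeq l l' -> ev l = ev l'.
Proof. exact: qeqP. Qed.

Let evM l l' : ev (qmuls l l') = ev l * ev l'.
Proof. exact: qevalM. Qed.

Let ev_iota (f : nat -> qterm) :
  ev [seq f k | k <- iota 0 8] = \sum_(k < 8) qteval w t u v (f k).
Proof. by rewrite /ev /qeval big_map -[iota 0 8]/(index_iota 0 8) big_mkord. Qed.

Let ev_Ru : ev (qR_u m) = YBop m t u.
Proof. by rewrite ev_iota; apply: eq_bigr => k _; rewrite /= mul1r. Qed.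

Let ev_Rv : ev (qR_v m) = YBop m t v.
Proof. by rewrite ev_iota; apply: eq_bigr => k _; rewrite /= mulr1. Qed.

Let ev_R1u : ev (qR1_u m) = YBop m 1 u.
Proof.
by rewrite ev_iota; apply: eq_bigr => k _; rewrite /= expr1n !expr0 !mulr1 mul1r.
Qed.

Let ev_R1v : ev (qR1_v m) = YBop m 1 v.
Proof.
by rewrite ev_iota; apply: eq_bigr => k _; rewrite /= expr1n !expr0 !mulr1.
Qed.

Let ev_seq1 x : ev [:: x] = qteval w t u v x.
Proof. by rewrite /ev /qeval big_seq1. Qed.

Let ev_q2 : ev q2 = 2%:R.
Proof.
by rewrite /ev /qeval !big_cons big_nil /= addr0 !expr0 !mulr1 scale1r mulr2n.
Qed.

Lemma two_neq0 : (2 : F) != 0. Proof. by rewrite pnatr_eq0. Qed.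

Lemma YBop_braid :
  YBop m t u * YBop m t v * YBop m t u = YBop m t v * YBop m t u * YBop m t v.
Proof.
have := eqP8 (qR_YB m8); rewrite !evM.
by rewrite ev_Ru ev_Rv !mulrA.
Qed.

(** Over the complex numbers, the second factor is $t\,f_t(u)^*$ when [u] is unitary and $|t|=1$.
    Being polynomial in [t], the identity also serves to invert $f_t(u)$ for every nonzero [t]. *)
Lemma YBop_adj :
  YBop m t u * (\sum_(k < 8) (w ^+ (7 * nth 0%N (wexp m) k) * t ^+ (~~ odd k)) *:
    u ^+ (7 * k)) = (8 * t)%:M.
Proof.
have := eqP8 (qR_adj m8); rewrite evM ev_Ru ev_iota => e.
transitivity (ev (nseq 8 (0, 1, 0, 0)%N)).
  rewrite -e; congr (_ * _); apply: eq_bigr => k _.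
  by rewrite /= mul1r.
rewrite /ev /qeval big_nseq iter_addr_0 /= !expr0 expr1 !mulr1 mul1r.
by rewrite -scalemx1 mulr_natl scalerMnl.
Qed.

(** For type I ([m < 4]) the even part of $f_t$ is a multiple of $1-u^4$ and the odd part one of
    $1+u^4$; for type II the factors are exchanged. Only the odd part carries [t]. *)
Lemma YBop_split :
  YBop m t u = (if (m < 4)%N then hpart t 1 (u ^+ 4) else hpart 1 t (u ^+ 4)) *
    YBop m 1 u.
Proof.
have := eqP8 (qR_split m8); rewrite !evM ev_q2 ev_Ru ev_R1u => e.
have -> : YBop m t u = 2^-1 *: (2%:R * YBop m t u).
  by rewrite mulr_natl -scaler_nat scalerA mulVf ?two_neq0 // scale1r.
rewrite e; case: ifP => _; rewrite -mulmxZl; congr (_ * _); rewrite /hpart;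
  congr (_ *: _); rewrite /ev /qeval !big_cons big_nil /= !addr0 !expr0 !mul1r ?mulr1.
all: rewrite muln1 w4 expr1 ?mulN1r addrA -!scalerDl.
all: by congr (_ *: _ + _ *: _); rewrite addrC.
Qed.

(** As $v^4$ anticommutes with [u], moving it across negates the odd part of $f_t(u)$. The two parts
    live on opposite eigenspaces of $u^4$, so this is multiplication by $-u^4$ for type I and by
    $u^4$ for type II. *)
Lemma YBop_J_u :
  exists s : bool, YBop m t u * v ^+ 4 = (-1) ^+ s *: (v ^+ 4 * u ^+ 4) * YBop m t u.
Proof.
exists (m < 4)%N; have := eqP8 (qR_J_u m8).
by rewrite !evM !ev_seq1 ev_Ru /= exprM w4 !expr0 !mulr1 scale1r.
Qed.

Lemma YBop_J_v :
  exists s : bool, YBop m t v * u ^+ 4 = (-1) ^+ s *: (v ^+ 4 * u ^+ 4) * YBop m t v.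
Proof.
exists (m < 4)%N; have := eqP8 (qR_J_v m8).
by rewrite !evM !ev_seq1 ev_Rv /= exprM w4 !expr0 !mulr1 mul1r scale1r.
Qed.

Let ev_hu p q : ev (qh_u p q) = 2 *: hpart (w ^+ p) (w ^+ q) (u ^+ 4).
Proof.
rewrite /hpart scalerA mulfV ?two_neq0 // scale1r.
rewrite /ev /qeval !big_cons big_nil /= !addr0 !expr0 !mul1r !mulr1.
by rewrite exprD w4 mulrN1 addrA -scalerDl -scalerDl.
Qed.

Let ev_hv p q : ev (qh_v p q) = 2 *: hpart (w ^+ p) (w ^+ q) (v ^+ 4).
Proof.
rewrite /hpart scalerA mulfV ?two_neq0 // scale1r.
rewrite /ev /qeval !big_cons big_nil /= !addr0 !expr0 !mulr1.
by rewrite exprD w4 mulrN1 addrA -scalerDl -scalerDl.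
Qed.

Let half (A B : 'M[F]_N) : 2%:R * A = 2 *: B -> A = B.
Proof.
by rewrite mulr_natl -scaler_nat; apply: scalerI; exact: two_neq0.
Qed.

(** Here $f_1(u)v=vf_1(wu)$, and $f_1(wu)/f_1(u)$ is a power of [u] times one eighth root of unity
    on each eigenspace of $u^4$. The choice [t = 1] matters: $u\mapsto wu$ exchanges these
    eigenspaces, so a general [t] would leave factors $t^{\pm1}$, possibly of infinite order. *)
Lemma YBop_conj_u : exists k p q : nat,
  YBop m 1 u * v = v * u ^+ k * hpart (w ^+ p) (w ^+ q) (u ^+ 4) * YBop m 1 u.
Proof.
have := qR1_conj_u m8; case: (kpq_u m) => [[k p] q] /eqP8.
rewrite !evM !ev_seq1 ev_R1u ev_q2 ev_hu /= !expr0 !mulr1 !scale1r => e.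
by exists k, p, q; apply: half; rewrite e mulmxZr mulmxZl.
Qed.

Lemma YBop_conj_v : exists k p q : nat,
  YBop m 1 v * u = u * v ^+ k * hpart (w ^+ p) (w ^+ q) (v ^+ 4) * YBop m 1 v.
Proof.
have := qR1_conj_v m8; case: (kpq_v m) => [[k p] q] /eqP8.
rewrite !evM !ev_seq1 ev_R1v ev_q2 ev_hv /= !expr0 !mul1r !mulr1 !scale1r => e.
by exists k, p, q; apply: half; rewrite e mulmxZr mulmxZl.
Qed.

End YangBaxter.

(** * Representations of the braid group *)

Section Braid.
Variables (n : nat) (G : groupType) (g : 'I_n.-1 -> G).
Local Open Scope group_scope.
Hypothesis g_yb : forall i j : 'I_n.-1, j = i.+1 :> nat ->
  g i * g j * g i = g j * g i * g j.
Hypothesis g_far : forall i j : 'I_n.-1, (i.+1 < j)%N -> g i * g j = g j * g i.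

Definition word_eval (u : braid_word n) : G :=
  foldr (fun l x => (if l.2 then g l.1 else (g l.1)^-1) * x) 1 u.

Lemma word_eval_cat u v : word_eval (u ++ v) = word_eval u * word_eval v.
Proof. by elim: u => [|l u IHu] /=; rewrite ?mul1g // IHu mulgA. Qed.

Lemma word_eval_rel u v : braid_rel u v -> word_eval u = word_eval v.
Proof.
elim=> {u v} [//|u v _ ->//|u v x _ -> _ ->//|u u' v v' _ IHu _ IHv|i b|i j ij|i j ij].
- by rewrite !word_eval_cat IHu IHv.
- by case: b; rewrite /= mulg1 ?mulgV ?mulVg.
- by rewrite /= !mulg1 !mulgA g_yb.
- by rewrite /= !mulg1 g_far.
Qed.

Definition braid_eval (x : braid n) : G := word_eval (repr x).

Lemma braid_eval_of u : braid_eval (braid_of u) = word_eval u.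
Proof. by apply/word_eval_rel/braid_ofP; exact: braid_of_repr. Qed.

Fact braid_eval_morph : {morph braid_eval : x y / x * y}.
Proof.
by move=> x y; rewrite -[x * y]/(braidM x y) /braidM braid_eval_of word_eval_cat.
Qed.

HB.instance Definition _ :=
  isMultiplicative.Build (braid n) G braid_eval braid_eval_morph.

Lemma braid_eval_sigma i : braid_eval (sigma i) = g i.
Proof. by rewrite braid_eval_of /= mulg1. Qed.

Lemma braid_eval_subgroup (K : set G) (x : braid n) :
  subgroup K -> (forall i, K (g i)) -> K (braid_eval x).
Proof.
move=> [K1 KM KV] Kg; rewrite /braid_eval.
by elim: (repr x) => [//|[i [|]] u IHu] /=; apply: KM => //; apply: KV.
Qed.

(** The second clause lets a property of the whole image be checked on the generators, as soon as it
    defines a subgroup. *)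
Lemma braid_rep_exists :
  exists rho : {multiplicative braid n -> G},
    (forall i, rho (sigma i) = g i) /\
    (forall K, subgroup K -> (forall i, K (g i)) -> range rho `<=` K).
Proof.
exists braid_eval; split; first exact: braid_eval_sigma.
by move=> K Ksub Kg _ [x _ <-]; apply: braid_eval_subgroup.
Qed.

End Braid.

Lemma subgroup_range (G K : groupType) (f : {multiplicative G -> K}) :
  subgroup (range f).
Proof.
have f1 : (f 1 = 1)%g.
  by apply: (@mulgI _ (f 1)%g); rewrite -gmulfM !mulg1.
split; first by exists 1%g.
  by move=> _ _ [x _ <-] [y _ <-]; exists (x * y)%g; rewrite // gmulfM.
move=> _ [x _ <-]; exists (x^-1)%g => //.
by apply: (@mulgI _ (f x)); rewrite -gmulfM !mulgV.
Qed.

(** Each fibre of [phi] on [B] lies in a single left coset of [A], so [T] bounds the number of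
    cosets. *)
Lemma finite_index_fun (G : groupType) (A B : set G) (T : finType) (phi : G -> T) :
    subgroup A ->
    (forall b c, B b -> B c -> phi b = phi c -> A (b^-1 * c)%g) ->
  finite_index_in A B.
Proof.
move=> [A1 AM AV] phiA.
(* The default [1] only arises at values that [phi] does not take on [B]. *)
pose rep y := xget 1%g [set b | B b /\ phi b = y].
apply: sub_finite_set (finite_image (fun y => [set rep y * x | x in A]%g)
  (@finite_finset T setT)) => _ [b Bb <-].
exists (phi b) => //.
have [Bc phi_c] : B (rep (phi b)) /\ phi (rep (phi b)) = phi b.
  by rewrite /rep; case: xgetP => [c _ //|/(_ b)[]].
apply/seteqP; split=> _ [x Ax <-].
  exists (b^-1 * (rep (phi b) * x))%g; last by rewrite mulVKg.
  by rewrite mulgA; apply: AM => //; exact: phiA.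
exists ((rep (phi b))^-1 * (b * x))%g; last by rewrite mulVKg.
by rewrite mulgA; apply: AM => //; apply: phiA.
Qed.

(** * Normalizers and finite index *)

Section Normalizer.
Variables (F : comUnitRingType) (N : nat).
Implicit Types (A : set 'M[F]_N) (g h : 'M[F]_N).

(** This is $gAg^{-1}\subseteq A$ written without an inverse, the form in which the torus identities
    deliver it; [normalizes] then says $gA=Ag$. *)
Definition transports A g := forall a, A a -> exists2 b, A b & g * a = b * g.

Definition normalizes A g :=
  transports A g /\ forall a, A a -> exists2 b, A b & a * g = g * b.

Lemma normalizesM A g h : normalizes A g -> normalizes A h -> normalizes A (g * h).
Proof.
move=> [g1 g2] [h1 h2]; split=> a Aa.
  have [b Ab hb] := h1 a Aa; have [c Ac gc] := g1 b Ab; exists c => //.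
  by rewrite -mulrA hb mulrA gc mulrA.
have [b Ab hb] := g2 a Aa; have [c Ac gc] := h2 b Ab; exists c => //.
by rewrite mulrA hb -mulrA gc mulrA.
Qed.

Lemma normalizesV A g h : g * h = 1 -> h * g = 1 -> normalizes A g -> normalizes A h.
Proof.
move=> gh hg [g1 g2]; split=> a Aa.
  have [b Ab ag] := g2 a Aa; exists b => //.
  by rewrite -[h * a]mulr1 -gh !mulrA -(mulrA h) ag mulrA hg mul1r.
have [b Ab ga] := g1 a Aa; exists b => //.
by rewrite -[a * h]mul1r -hg -!mulrA (mulrA g) ga -mulrA gh mulr1.
Qed.

Lemma normalizes1 A : normalizes A 1.
Proof. by split=> a Aa; exists a; rewrite ?mulr1 ?mul1r. Qed.

End Normalizer.

(** * Finite index from a finite set stable under conjugation *)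

Section FiniteIndex.
Variables (F : fieldType) (N : nat) (H : set 'M[F]_N) (S : seq 'M[F]_N).

Definition factorization (g : glmx F N) (s : glmx F N * glmx F N) : Prop :=
  [/\ normalizes H (val s.1), transports [set` S] (val s.1),
      subalgebra_units H s.2 & g = (s.1 * s.2)%g].

Variables (I : finType) (x : I -> 'M[F]_N) (Gamma : set (glmx F N)).
Hypothesis Hsub : unital_subalgebra H.
Hypothesis Hcomm : forall a b, H a -> H b -> a * b = b * a.
Hypothesis Sx : forall i, x i \in S.
Hypothesis x_centralizer :
  forall M, (forall i, M * x i = x i * M) -> exists c, M = c%:M.
Hypothesis Gamma_group : subgroup Gamma.
Hypothesis Gamma_dec : forall g, Gamma g -> exists s, factorization g s.

Lemma subgroup_units : subgroup (subalgebra_units H).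
Proof.
have [H1 HL HM] := Hsub; split.
- by split; rewrite ?invg1; exact: H1.
- move=> a b [Ha HaV] [Hb HbV]; split; first exact: HM.
  by rewrite invgM; apply: HM.
- by move=> a [Ha HaV]; split; rewrite ?invgK.
Qed.

Lemma scalar_units (a : glmx F N) c : val a = c%:M -> subalgebra_units H a.
Proof.
have [H1 HL _] := Hsub.
have H0 : H 0 by rewrite -(subrr 1%:M) addrC -scaleN1r; apply: HL.
have Hs d : H d%:M by rewrite -scalemx1 -[_ *: _]addr0; apply: HL.
move=> ac; split; first by rewrite ac.
suff -> : val (a^-1 : glmx F N)%g = (c^-1)%:M by [].
by rewrite -[LHS]/(invmx (val a)) ac invmx_scalar.
Qed.

Let A := Gamma `&` subalgebra_units H.

Lemma subgroup_unit_part : subgroup A.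
Proof.
have [G1 GM GV] := Gamma_group; have [U1 UM UV] := subgroup_units.
split; first by split.
  by move=> a b [Ga Ua] [Gb Ub]; split; [apply: GM | apply: UM].
by move=> a [Ga Ua]; split; [apply: GV | apply: UV].
Qed.

Lemma units_conj (g a : glmx F N) : normalizes H (val g) ->
  subalgebra_units H a -> subalgebra_units H (g * a * g^-1)%g.
Proof.
move=> [gH _] Ha.
suff conjH (b : glmx F N) : H (val b) -> H (val (g * b * g^-1)%g).
  case: Ha => Ha HaV; split; first exact: conjH.
  by rewrite !invgM invgK mulgA; apply: conjH.
move=> Hb; have [c Hc gbc] := gH _ Hb.
rewrite -[val _]/(val g *m val b *m invmx (val g)) -[_ *m val b]/(_ * _) gbc.
by rewrite mulmxK ?(valP g).
Qed.

Lemma abelian_unit_part : abelian_set A.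
Proof. by move=> a b [_ [Ha _]] [_ [Hb _]]; apply/val_inj/Hcomm. Qed.

(** With $g=sh$, conjugation by [h] stays among the units of [H], and [s] normalizes [H]. *)
Lemma normal_unit_part : normal_in A Gamma.
Proof.
split; [exact: subgroup_unit_part | by move=> a [] | move=> g a Gg [Ga Ua]].
have [G1 GM GV] := Gamma_group; have [U1 UM UV] := subgroup_units.
split; first exact: (GM _ _ (GM _ _ Gg Ga) (GV _ Gg)).
have [[s h] /= [sH _ hH ->]] := Gamma_dec Gg.
rewrite invgM !mulgA -(mulgA s) -(mulgA s).
apply: units_conj => //.
exact: (UM _ _ (UM _ _ hH Ua) (UV _ hH)).
Qed.

(** The invariant [phi g] records, as positions in [S], the conjugates of the [x i] by the first
    factor of a chosen factorization of [g]. If [b] and [c] share it, their first factors [p] and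
    [q] have $p^{-1}q$ scalar, so $b^{-1}c$ is a product of units of [H]. *)
Lemma finite_index_unit_part : finite_index_in A Gamma.
Proof.
have [G1 GM GV] := Gamma_group; have [U1 UM UV] := subgroup_units.
pose dec g := xget (1, 1)%g [set s | factorization g s].
have decP g : Gamma g -> factorization g (dec g).
  by move=> /Gamma_dec[s sP]; rewrite /dec; case: xgetP => [r _ //|/(_ s) []].
pose cx g i := val (dec g).1 * x i * invmx (val (dec g).1).
pose phi g := [ffun i => inord (index (cx g i) S) : 'I_(size S).+1].
have cxS g i : Gamma g -> cx g i \in S.
  move=> /decP[_ /(_ _ (Sx i))[y Sy gxy] _ _].
  by rewrite /cx gxy -[_ * _]/(_ *m _) mulmxK ?(valP (dec g).1).
apply: (@finite_index_fun _ _ _ _ phi); first exact: subgroup_unit_part.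
move=> b c Gb Gc /ffunP eq_phi.
split; first by apply: GM => //; apply: GV.
have eq_cx i : cx b i = cx c i.
  have := congr1 (@nat_of_ord _) (eq_phi i).
  rewrite !ffunE !inordK ?ltnS ?index_size // => eqi.
  by rewrite -[LHS](nth_index 0 (cxS b i Gb)) eqi nth_index ?cxS.
have [_ _ hb ->] := decP _ Gb; have [_ _ hc ->] := decP _ Gc.
set p := (dec b).1 in eq_cx *; set q := (dec c).1 in eq_cx *.
rewrite invgM !mulgA -(mulgA _ p^-1%g q).
apply: (UM) => //; apply: (UM) => //; first exact: UV.
have [d pq] : exists d, val (p^-1 * q)%g = d%:M.
  apply: x_centralizer => i; rewrite -[val _]/(invmx (val p) * val q).
  have := eq_cx i; rewrite /cx -/p -/q => e.
  have Vp : invmx (val p) * val p = 1 by exact: mulVmx (valP p).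
  have Vq : invmx (val q) * val q = 1 by exact: mulVmx (valP q).
  transitivity (invmx (val p) * (val q * x i * invmx (val q)) * val q).
    by rewrite -!mulrA Vq mulr1.
  by rewrite -e !mulrA Vp mul1r.
exact: scalar_units pq.
Qed.

Lemma virtually_abelian_extension : virtually_abelian Gamma.
Proof.
exists A; split; first exact: subgroup_unit_part.
- by move=> a [].
- exact: abelian_unit_part.
- exact: finite_index_unit_part.
Qed.

End FiniteIndex.

(** * The root of unity [w] and the coefficients of the vectors $C_m(t)$ *)

Section RootOfUnity.
Variable R : realType.
Local Notation C := R[i].
Local Notation w := (w R).

Lemma w_sqr : w ^+ 2 = 'i%C.
Proof.
have h : 2 * pi / 8 + 2 * pi / 8 = pi / 2 :> R by field.
have := cosD (2 * pi / 8 : R) (2 * pi / 8); rewrite h cos_pihalf => e1.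
have := sinD (2 * pi / 8 : R) (2 * pi / 8); rewrite h sin_pihalf => e2.
rewrite expr2 /Defs.w; set c := cos _ in e1 e2 *; set s := sin _ in e1 e2 *.
apply/eqP; rewrite eq_complex /=; apply/andP.
by split; apply/eqP; [rewrite e1|rewrite e2 addrC mulrC].
Qed.

Lemma w_exp4 : w ^+ 4 = -1.
Proof. by rewrite (exprM w 2 2) w_sqr sqr_i. Qed.

Lemma w_prim : 8.-primitive_root w.
Proof.
have w8 : w ^+ 8 = 1 by rewrite (exprM w 4 2) w_exp4 sqrrN expr1n.
have [m m_prim m8] := prim_order_exists (isT : (0 < 8)%N) w8.
suff /negP m4 : ~~ (m %| 4)%N.
  suff -> : 8%N = m by [].
  have : m \in divisors 8 by rewrite -dvdn_divisors.
  by rewrite !inE => /or4P[]/eqP e; move: m4; rewrite e.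
apply/negP; rewrite (prim_order_dvd m_prim) w_exp4 => /eqP h.
have : (-1 : C) + 1 = 1 + 1 by rewrite h.
by move/eqP; rewrite addNr eq_sym -(natrD _ 1 1) pnatr_eq0.
Qed.

Lemma w_eq_exp i j : (i < 8)%N -> (j < 8)%N -> w ^+ i = w ^+ j -> i = j.
Proof.
by move=> i8 j8 /eqP; rewrite (eq_prim_root_expr w_prim) !modn_small // => /eqP.
Qed.

Lemma Cvec_exp (m : 'I_8) (t : C) (k : 'I_8) :
  Cvec m t 0 k = w ^+ nth 0%N (wexp m) k * t ^+ odd k.
Proof.
have w6 : w ^+ 6 = - 'i%C by rewrite (exprD w 4 2) w_exp4 w_sqr mulN1r.
case: m => m; do 8?[case: m => [|m]] => // m8;
  rewrite /Cvec /= mxE; case: k => k; do 8?[case: k => [|k]] => // k8;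
  rewrite /= ?expr0 ?w_sqr ?w_exp4 ?w6 ?expr1; ring.
Qed.

End RootOfUnity.

(** * Tensor powers in base 8 *)

Section Digits.
Local Open Scope nat_scope.

Definition digit (e p : nat) : nat := p %/ 8 ^ e %% 8.

Lemma digit_inj k a b : a < 8 ^ k -> b < 8 ^ k ->
  (forall e, e < k -> digit e a = digit e b) -> a = b.
Proof.
elim: k a b => [|k IHk] a b; first by rewrite expn0 !ltnS !leqn0 => /eqP-> /eqP->.
rewrite expnSr => ak bk eq_ab.
rewrite (divn_eq a 8) (divn_eq b 8); congr (_ * _ + _).
  apply: IHk; rewrite ?ltn_divLR // => e ek.
  by have := eq_ab e.+1 ek; rewrite /digit expnS !divnMA.
by have := eq_ab 0 isT; rewrite /digit expn0 !divn1.
Qed.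

Lemma digit_div r e p : digit e (p %/ 8 ^ r) = digit (r + e) p.
Proof. by rewrite /digit -divnMA -expnD. Qed.

Lemma digit_mod r e p : e < r -> digit e (p %% 8 ^ r) = digit e p.
Proof.
move=> er; rewrite /digit {2}(divn_eq p (8 ^ r)).
have -> : 8 ^ r = 8 ^ (r - e.+1) * 8 * 8 ^ e.
  by rewrite -expnSr -expnD; congr (_ ^ _); lia.
by rewrite mulnA divnMDl ?expn_gt0 // mulnA modnMDl.
Qed.

(** The left side is what makes an entry of $1\otimes A\otimes 1$ possibly nonzero, when [A] acts on
    the factor of digit [r]. *)
Lemma digits_neq n r p q : r < n -> p < 8 ^ n -> q < 8 ^ n ->
  (p %/ 8 ^ r.+1 == q %/ 8 ^ r.+1) && (p %% 8 ^ r == q %% 8 ^ r) <->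
  (forall e, e < n -> e != r -> digit e p = digit e q).
Proof.
move=> rn pn qn; split=> [/andP[/eqP eq_div /eqP eq_mod] e en er|eq_dig].
  case: (ltngtP e r) er => // er _.
    by rewrite -(digit_mod _ er) eq_mod digit_mod.
  by rewrite -(subnKC er) -!digit_div eq_div.
have bound x : x < 8 ^ n -> x %/ 8 ^ r.+1 < 8 ^ (n - r.+1).
  by move=> xn; rewrite ltn_divLR ?expn_gt0 // -expnD subnK.
apply/andP; split; apply/eqP.
  apply: (@digit_inj (n - r.+1)); rewrite ?bound // => e en.
  by rewrite !digit_div; apply: eq_dig; lia.
apply: (@digit_inj r); rewrite ?ltn_mod ?expn_gt0 // => e er.
by rewrite !digit_mod //; apply: eq_dig; lia.
Qed.

Lemma modn_exp8S r p q :
  (p %% 8 ^ r.+1 == q %% 8 ^ r.+1) =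
  (digit r p == digit r q) && (p %% 8 ^ r == q %% 8 ^ r).
Proof.
have split8 x : x %% 8 ^ r.+1 = digit r x * 8 ^ r + x %% 8 ^ r.
  rewrite {1}(divn_eq x (8 ^ r)) {1}(divn_eq (x %/ 8 ^ r) 8) mulnDl -mulnA -expnS.
  rewrite -addnA modnMDl.
  rewrite modn_small // expnS.
  have : x %% 8 ^ r < 8 ^ r by rewrite ltn_mod expn_gt0.
  have : x %/ 8 ^ r %% 8 < 8 by rewrite ltn_mod.
  by nia.
apply/eqP/andP => [e|[/eqP e1 /eqP e2]]; last by rewrite !split8 e1 e2.
split; apply/eqP.
  by rewrite -[LHS](digit_mod _ (ltnSn r)) e digit_mod.
by rewrite -(modn_dvdm p (dvdn_exp2l 8 (leqnSn r))) e modn_dvdm // dvdn_exp2l.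
Qed.

End Digits.

(** * Basis vectors as functions from tensor factors to Z/8 *)

Section Coordinates.
Variable n : nat.
Implicit Types (p q : 'I_(8 ^ n)) (i j : 'I_n).

(** Factor 0 is the most significant base-8 digit, as in the Kronecker product. *)
Definition place i : nat := (n - i.+1)%N.

Lemma place_lt i : (place i < n)%N.
Proof. by rewrite /place; have := ltn_ord i; lia. Qed.

Definition coords p : {ffun 'I_n -> 'Z_8} := [ffun i => inZp (digit (place i) p)].

Lemma coordsE p i : coords p i = digit (place i) p :> nat.
Proof. by rewrite ffunE /= modn_mod. Qed.

Lemma coords_inj : injective coords.
Proof.
move=> p q pq; apply/val_inj/(@digit_inj n) => //= e en.
have en' : (n - e.+1 < n)%N by lia.
have pl : place (Ordinal en') = e by rewrite /place /=; lia.
by rewrite -[in LHS]pl -[in RHS]pl -!coordsE pq.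
Qed.

Lemma coords_bij : bijective coords.
Proof.
apply: inj_card_bij coords_inj _.
by rewrite card_ffun !card_ord.
Qed.

Lemma uncoords_exists : exists g, cancel coords g /\ cancel g coords.
Proof. by case: coords_bij => g cg gc; exists g. Qed.

Definition uncoords : {ffun 'I_n -> 'Z_8} -> 'I_(8 ^ n) :=
  projT1 (cid uncoords_exists).

Lemma coordsK : cancel coords uncoords.
Proof. by rewrite /uncoords; case: cid => g []. Qed.

Lemma uncoordsK : cancel uncoords coords.
Proof. by rewrite /uncoords; case: cid => g []. Qed.

Definition unit_vec i : {ffun 'I_n -> 'Z_8} := [ffun j => (j == i)%:R].

Lemma add_unit_vec (f : {ffun 'I_n -> 'Z_8}) i j :
  (f + unit_vec i) j = f j + (j == i)%:R.
Proof. by rewrite ffunE [unit_vec i j]ffunE. Qed.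

Definition shift i p : 'I_(8 ^ n) := uncoords (coords p + unit_vec i).

Lemma coords_shift i p : coords (shift i p) = coords p + unit_vec i.
Proof. exact: uncoordsK. Qed.

Lemma coords_iter_shift i k p :
  coords (iter k (shift i) p) = coords p + unit_vec i *+ k.
Proof.
elim: k => [|k IHk]; first by rewrite mulr0n addr0.
by rewrite /= coords_shift IHk mulrSr addrA.
Qed.

Lemma shift_inj i : injective (shift i).
Proof.
by move=> p q /(congr1 coords); rewrite !coords_shift => /addIr/coords_inj.
Qed.

Lemma shift_eq i p q : (p == shift i q) =
  (coords p i == coords q i + 1) &&
  ((p %/ 8 ^ (place i).+1 == q %/ 8 ^ (place i).+1) &&
    (p %% 8 ^ place i == q %% 8 ^ place i))%N.
Proof.
have digE e : (e < n)%N ->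
    exists2 j, place j = e & forall r : 'I_(8 ^ n), digit e r = coords r j.
  move=> en; have en' : (n - e.+1 < n)%N by lia.
  have pl : place (Ordinal en') = e by rewrite /place /=; lia.
  by exists (Ordinal en') => // r; rewrite coordsE pl.
rewrite -(inj_eq coords_inj) coords_shift.
apply/eqP/andP => [e|[/eqP ei /digits_neq eq_dig]].
  split; first by rewrite e add_unit_vec eqxx.
  apply/(@digits_neq n); rewrite ?place_lt // => f fn fi.
  have [j pj dj] := digE f fn; rewrite !dj e add_unit_vec.
  case: (eqVneq j i) => [ji|_]; last by rewrite addr0.
  by rewrite -pj ji eqxx in fi.
apply/ffunP => j; rewrite add_unit_vec. case: eqP => [->|ji]; first exact: ei.
rewrite addr0; apply: val_inj; rewrite /= !coordsE.
apply: (eq_dig n); rewrite ?place_lt //.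
apply/eqP => e; apply: ji; apply: val_inj; move: e; rewrite /place /=.
by have := ltn_ord i; have := ltn_ord j; lia.
Qed.

End Coordinates.

Lemma tensmx1 (K : pzRingType) a b :
  (1%:M : 'M[K]_a) *t (1%:M : 'M[K]_b) = 1%:M.
Proof.
apply/matrixP => i j; rewrite !mxE -natrM mulnb -!val_eqE /=.
congr (_%:R); congr nat_of_bool; apply/andP/eqP => [[/eqP e1 /eqP e2]|->//].
by rewrite (divn_eq i b) e1 e2 -divn_eq.
Qed.

(** * Operators on two adjacent factors *)

Section OnPair.
Variables (C : comPzRingType) (n k : nat) (lt_kn : (k.+1 < n)%N).

Lemma on_pairM (A B : 'M[C]_(8 * 8)) :
  on_pair lt_kn (A * B) = on_pair lt_kn A * on_pair lt_kn B.
Proof.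
rewrite /on_pair; set e := dim_on_pair _.
rewrite -[_ * castmx _ _]/(_ *m _).
case: _ / e => /=; rewrite !castmx_id !tensmx_mul !mul1mx //.
Qed.

Lemma on_pair1 : on_pair lt_kn (1 : 'M[C]_(8 * 8)) = 1.
Proof.
rewrite /on_pair; set e := dim_on_pair _.
case: _ / e => /=; rewrite !castmx_id.
by rewrite -[X in _ *t X *t _]/(1%:M) !tensmx1.
Qed.

Lemma on_pairX (A : 'M[C]_(8 * 8)) j : on_pair lt_kn (A ^+ j) = on_pair lt_kn A ^+ j.
Proof.
by elim: j => [|j IHj]; rewrite ?expr0 ?on_pair1 // !exprS on_pairM IHj.
Qed.

Lemma on_pairZ (c : C) (A : 'M[C]_(8 * 8)) :
  on_pair lt_kn (c *: A) = c *: on_pair lt_kn A.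
Proof.
by apply/matrixP => p q; rewrite !(castmxE, mxE) !mulrA [_ * c]mulrC.
Qed.

Lemma on_pairD (A B : 'M[C]_(8 * 8)) :
  on_pair lt_kn (A + B) = on_pair lt_kn A + on_pair lt_kn B.
Proof. by apply/matrixP => p q; rewrite !(castmxE, mxE) mulrDr mulrDl. Qed.

Lemma on_pair_sum (I : Type) (r : seq I) (c : I -> C) (A : I -> 'M[C]_(8 * 8)) :
  on_pair lt_kn (\sum_(i <- r) c i *: A i) = \sum_(i <- r) c i *: on_pair lt_kn (A i).
Proof.
elim: r => [|i r IHr]; last by rewrite !big_cons on_pairD on_pairZ IHr.
by rewrite !big_nil -(scale0r 0) on_pairZ scale0r.
Qed.

End OnPair.

(** * Monomial matrices over the eighth roots of unity *)

Section Monomial.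
Variables (R : realType) (N : nat).
Local Notation w := (w R).
Implicit Types (s : 'I_N -> 'I_N) (c : 'I_N -> nat).

Definition monomial s c : 'M[R[i]]_N :=
  \matrix_(p, q) if p == s q then w ^+ c q else 0.

Lemma mulmx_monomial (A : 'M[R[i]]_N) s c p q :
  (A * monomial s c) p q = A p (s q) * w ^+ c q.
Proof.
rewrite -[_ * _]/(_ *m _) mxE (bigD1 (s q)) //= mxE eqxx big1 ?addr0 // => r /negPf ne.
by rewrite mxE ne mulr0.
Qed.

Lemma monomialM s c s' c' :
  monomial s c * monomial s' c' = monomial (s \o s') (fun q => c (s' q) + c' q)%N.
Proof.
apply/matrixP => p q; rewrite mulmx_monomial !mxE /=.
by case: eqP => _; rewrite ?mul0r // exprD.
Qed.

Lemma eq_monomial s c s' c' : s =1 s' -> (forall q, c q = c' q %[mod 8]) ->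
  monomial s c = monomial s' c'.
Proof.
move=> ss cc; apply/matrixP => p q; rewrite !mxE ss; case: ifP => // _.
by rewrite -(prim_expr_mod (w_prim R)) cc prim_expr_mod // w_prim.
Qed.

Lemma monomial1 s c : s =1 id -> (forall q, 8 %| c q)%N -> monomial s c = 1.
Proof.
move=> s1 c8; apply/matrixP => p q; rewrite !mxE s1; case: eqP => // _.
by rewrite -(prim_expr_mod (w_prim R)) (eqP (c8 q)).
Qed.

Lemma scale_monomial k s c :
  w ^+ k *: monomial s c = monomial s (fun q => k + c q)%N.
Proof.
apply/matrixP => p q; rewrite !mxE; case: ifP => _; last by rewrite mulr0.
by rewrite exprD.
Qed.

Definition is_monomial (A : 'M[R[i]]_N) : Prop := exists s c, A = monomial s c.

(** Exponents matter only modulo 8. *)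
Lemma finite_monomial : finite_set [set A | is_monomial A].
Proof.
pose f (x : {ffun 'I_N -> 'I_N} * {ffun 'I_N -> 'I_8}) := monomial x.1 (fun q => x.2 q).
apply: sub_finite_set (finite_image f (@finite_finset _ setT)) => _ [s [c ->]].
exists ([ffun q => s q], [ffun q => inord (c q %% 8)]) => //.
apply: eq_monomial => q; rewrite /= ffunE // inordK ?modn_mod //.
by rewrite ltn_mod.
Qed.

End Monomial.

(** * The operators $X_i$ and $Z_i$ as monomial matrices *)

Section Paulis.
Variables (R : realType) (n : nat).
Local Notation w := (w R).
Implicit Types i j : 'I_n.

Definition tensor_X i : 'M[R[i]]_(8 ^ n) := on_factor (ltn_ord i) (X R).
Definition tensor_Z i : 'M[R[i]]_(8 ^ n) := on_factor (ltn_ord i) (Z R).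

Lemma on_factorE i (A : 'M[R[i]]_8) p q :
  on_factor (ltn_ord i) A p q =
  if ((p %/ 8 ^ (place i).+1 == q %/ 8 ^ (place i).+1) &&
      (p %% 8 ^ place i == q %% 8 ^ place i))%N
  then A (coords p i) (coords q i) else 0.
Proof.
rewrite !(castmxE, mxE) /= -!val_eqE /= !expnSr !divnMA.
rewrite [A _ _](_ : _ = A (coords p i) (coords q i)); last first.
  by congr (A _ _); apply: val_inj; rewrite /= coordsE.
by case: eqP; case: eqP; rewrite /= ?mulr1 ?mul1r ?mulr0 ?mul0r.
Qed.

Lemma XopE i : tensor_X i = monomial R (shift i) (fun=> 0%N).
Proof.
apply/matrixP => p q; rewrite on_factorE !mxE shift_eq.
by case: (_ == _ + 1); case: (_ && _); rewrite //= ?expr0.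
Qed.

Lemma ZopE i : tensor_Z i = monomial R id (fun q => coords q i).
Proof.
apply/matrixP => p q; rewrite on_factorE !mxE.
case: (eqVneq p q) => [->|/eqP pq]; first by rewrite !eqxx /= mulr1n.
case: ifP => // eq_dig; case: (coords p i =P coords q i) => // ei.
case: pq; apply: (@coords_inj n).
apply/ffunP => j; apply: val_inj; rewrite /= !coordsE.
have [->|ji] := eqVneq j i; first by rewrite -!coordsE ei.
have /(digits_neq (place_lt i) (ltn_ord p) (ltn_ord q)) := eq_dig.
apply; rewrite ?place_lt //.
apply: contra ji => /eqP e; apply/eqP/val_inj; move: e; rewrite /place /=.
by have := ltn_ord i; have := ltn_ord j; lia.
Qed.

End Paulis.

(** * Commutation up to a power of [w] *)

Section WCommutation.
Variables (R : realType) (N : nat).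
Local Notation w := (w R).
Implicit Types A B C : 'M[R[i]]_N.

(** Exponents are naturals read modulo 8, so that 7 stands for -1. *)
Definition wcomm (k : nat) A B : Prop := A * B = w ^+ k *: (B * A).

Lemma wcommMr k l A B C : wcomm k A B -> wcomm l A C -> wcomm (k + l) A (B * C).
Proof.
rewrite /wcomm => AB AC.
by rewrite mulrA AB mulmxZl -(mulrA B A) AC mulmxZr scalerA mulrA exprD.
Qed.

Lemma wcommMl k l A B C : wcomm k A C -> wcomm l B C -> wcomm (k + l) (A * B) C.
Proof.
rewrite /wcomm => AC BC.
by rewrite -mulrA BC mulmxZr (mulrA A C) AC mulmxZl scalerA mulrA exprD mulrC.
Qed.

Lemma wcomm0 A B : wcomm 0 A B <-> A * B = B * A.
Proof. by rewrite /wcomm expr0 scale1r. Qed.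

Lemma wcomm8 k A B : wcomm (k %% 8) A B <-> wcomm k A B.
Proof. by rewrite /wcomm (prim_expr_mod (w_prim R)). Qed.

Lemma wcomm_sym k l A B : (k + l)%N = 8%N -> wcomm k A B -> wcomm l B A.
Proof.
rewrite /wcomm => kl ->; rewrite scalerA -exprD addnC kl.
by rewrite (prim_expr_order (w_prim R)) scale1r.
Qed.

Lemma wcommX k j A B : wcomm k A B -> wcomm (k * j) (A ^+ j) B.
Proof.
move=> AB; elim: j => [|j IHj].
  by rewrite muln0 expr0; apply/wcomm0; rewrite mulr1 mul1r.
by rewrite exprS mulnS; apply: wcommMl.
Qed.

Lemma wcommXr k j A B : wcomm k A B -> wcomm (k * j) A (B ^+ j).
Proof.
move=> AB; elim: j => [|j IHj].
  by rewrite muln0 expr0; apply/wcomm0; rewrite mulr1 mul1r.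
by rewrite exprS mulnS; apply: wcommMr.
Qed.

End WCommutation.

(** * Relations and centralizer of the $X_i$ and $Z_i$ *)

Section PauliRelations.
Variables (R : realType) (n : nat).
Local Notation w := (w R).
Implicit Types i j : 'I_n.
Local Notation Xop := (@tensor_X R n).
Local Notation Zop := (@tensor_Z R n).

Lemma unit_vec8 i : unit_vec i *+ 8 = 0.
Proof.
apply/ffunP => j; rewrite ffunMnE [unit_vec i j]ffunE ffunE.
by rewrite -mulr_natl; case: (j == i); rewrite ?mulr0 //; apply: val_inj.
Qed.

Lemma Xop8 i : Xop i ^+ 8 = 1.
Proof.
have XopX k : Xop i ^+ k = monomial R (iter k (shift i)) (fun=> 0%N).
  elim: k => [|k IHk]; first by rewrite expr0 monomial1.
  by rewrite exprS IHk XopE monomialM; apply: eq_monomial.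
rewrite XopX; apply: monomial1 => // q; apply: (@coords_inj n).
by rewrite coords_iter_shift unit_vec8 addr0.
Qed.

Lemma Zop8 i : Zop i ^+ 8 = 1.
Proof.
have ZopX k : Zop i ^+ k = monomial R id (fun q => k * coords q i)%N.
  elim: k => [|k IHk]; first by rewrite expr0 monomial1.
  by rewrite exprS IHk ZopE monomialM; apply: eq_monomial => // q; rewrite mulSn.
by rewrite ZopX; apply: monomial1 => // q; apply: dvdn_mulr.
Qed.

Lemma XopC i j : Xop i * Xop j = Xop j * Xop i.
Proof.
rewrite !XopE !monomialM; apply: eq_monomial => // q; apply: (@coords_inj n).
by rewrite /= !coords_shift addrAC.
Qed.

Lemma ZopC i j : Zop i * Zop j = Zop j * Zop i.
Proof. by rewrite !ZopE !monomialM; apply: eq_monomial => // q; rewrite addnC. Qed.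

Lemma ZXop i j : wcomm (i == j) (Zop i) (Xop j).
Proof.
rewrite /wcomm XopE ZopE !monomialM scale_monomial.
apply: eq_monomial => // q; rewrite coords_shift add_unit_vec addn0.
case: (i == j); last by rewrite addr0.
by rewrite -[(_ + 1)%R]/(Zp_add _ _) /= modn_mod addnC.
Qed.

Lemma XZop i j : wcomm (7 * (i == j)) (Xop i) (Zop j).
Proof.
have := ZXop j i; rewrite (eq_sym i); case: (j == i).
  by apply: wcomm_sym.
by rewrite !wcomm0.
Qed.

(** The joint eigenvalues of the [Zop i] separate the basis vectors, so [M] is diagonal; the shifts
    [Xop i] act transitively on the basis, so the diagonal is constant. *)
Lemma Pauli_centralizer (M : 'M[R[i]]_(8 ^ n)) :
    (forall i, M * Xop i = Xop i * M) -> (forall i, M * Zop i = Zop i * M) ->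
  exists c, M = c%:M.
Proof.
move=> MX MZ.
have coords0 p q : M p q != 0 -> p = q.
  move=> Mpq; apply: (@coords_inj n); apply/ffunP => i; apply: val_inj.
  apply: (@w_eq_exp R); rewrite ?ltn_ord //.
  have := congr1 (fun A : 'M_(8 ^ n) => A p q) (MZ i).
  rewrite ZopE mulmx_monomial /= -[_ * M]/(_ *m _) mxE (bigD1 p) //= mxE eqxx.
  rewrite big1 ?addr0 => [|r /negPf rp]; last by rewrite mxE eq_sym rp mul0r.
  by rewrite mulrC => /(mulIf Mpq).
have Mdiag p q : p != q -> M p q = 0.
  by move=> pq; apply/eqP; apply: contraNT pq => /coords0 ->.
have Mshift i q : M (shift i q) (shift i q) = M q q.
  have := congr1 (fun A : 'M_(8 ^ n) => A (shift i q) q) (MX i).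
  rewrite XopE mulmx_monomial expr0 mulr1 => ->.
  rewrite -[_ * M]/(_ *m _) mxE (bigD1 q) //= mxE eqxx expr0 mul1r.
  rewrite big1 ?addr0 // => r /negPf rq.
  by rewrite mxE (inj_eq (@shift_inj n i)) eq_sym rq mul0r.
pose g f := M (uncoords f) (uncoords f).
have gD f i k : g (f + unit_vec i *+ k) = g f.
  elim: k => [|k IHk]; first by rewrite addr0.
  rewrite mulrSr addrA -IHk; set h := f + _.
  by rewrite /g -(Mshift i (uncoords h)) /shift uncoordsK.
have gsum (h : 'I_n -> 'Z_8) (r : seq 'I_n) : g (\sum_(i <- r) unit_vec i *+ h i) = g 0.
  elim: r => [|a r IHr]; first by rewrite big_nil.
  by rewrite big_cons addrC gD.
have g0 f : g f = g 0.
  have -> : f = \sum_i unit_vec i *+ f i; last exact: gsum.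
  apply/ffunP => j; rewrite sum_ffunE (bigD1 j) //= big1.
    by rewrite addr0 ffunMnE [unit_vec j j]ffunE eqxx natr_Zp.
  by move=> i ij; rewrite ffunMnE [unit_vec i j]ffunE eq_sym (negPf ij) mul0rn.
exists (g 0); apply/matrixP => p q; rewrite mxE; case: eqP => [<-|/eqP pq].
  by rewrite -(g0 (coords p)) /g coordsK.
by rewrite Mdiag.
Qed.

Lemma on_pair_XZ (k : 'I_n.-1) (i j : 'I_n) : i = k :> nat -> j = k.+1 :> nat ->
  on_pair (ltn_ord_pred k) (X R *t Z R) = Xop i * Zop j.
Proof.
move=> ik jk; apply/matrixP => p q.
rewrite ZopE mulmx_monomial XopE !mxE shift_eq !(castmxE, mxE) /= -!val_eqE /=.
have pl : place i = (n - k.+2).+1.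
  by rewrite /place ik; have := ltn_ord_pred k; lia.
have pj : place j = (n - k.+2)%N by rewrite /place jk.
set r := (n - k.+2)%N in pl pj *.
have e1 (x : 'I_(8 ^ n)) : (x %/ 8 ^ r %/ (8 * 8) = x %/ 8 ^ r.+2)%N.
  by rewrite -divnMA !expnS mulnC mulnA.
have e2 (x : 'I_(8 ^ n)) : ((x %/ 8 ^ r) %% (8 * 8) %/ 8 = coords x i)%N.
  by rewrite -modn_divl coordsE pl /digit expnSr divnMA.
have e3 (x : 'I_(8 ^ n)) : ((x %/ 8 ^ r) %% (8 * 8) %% 8 = coords x j)%N.
  by rewrite modn_dvdm // coordsE pj.
rewrite pl modn_exp8S !e1 !e2 !e3 -pj -!coordsE expr0.
by case: eqP => _; case: eqP => _; case: eqP => [->|_]; case: eqP => _;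
  rewrite /= ?mulr1n ?mulr0n ?mulr0 ?mul0r ?mulr1 ?mul1r ?mulr0 ?mul0r.
Qed.


End PauliRelations.


(** * Unitarity *)

Lemma tensmxX (K : comPzRingType) a b (A : 'M[K]_a) (B : 'M[K]_b) k :
  (A *t B : 'M_(a * b)) ^+ k = (A ^+ k) *t (B ^+ k).
Proof.
elim: k => [|k IHk]; first by rewrite !expr0 -[RHS]/(1%:M *t 1%:M) tensmx1.
by rewrite !exprS IHk; exact: tensmx_mul.
Qed.

Section Adjoint.
Local Open Scope sesquilinear_scope.
Variables (C : numClosedFieldType) (N : nat).
Implicit Types A B : 'M[C]_N.

Lemma adjM A B : (A * B)^t* = B^t* * A^t*.
Proof. by rewrite -[A * B]/(A *m B) trmx_mul map_mxM. Qed.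

Lemma adjX A k : (A ^+ k)^t* = (A^t*) ^+ k.
Proof.
elim: k => [|k IHk]; first by rewrite !expr0 trmx1 map_mx1.
by rewrite exprS adjM IHk -exprSr.
Qed.

Lemma adj_sum (I : Type) (r : seq I) (c : I -> C) (A : I -> 'M[C]_N) :
  (\sum_(i <- r) c i *: A i)^t* = \sum_(i <- r) (c i)^* *: (A i)^t*.
Proof.
rewrite raddf_sum map_mx_sum; apply: eq_bigr => i _.
apply/matrixP => p q; rewrite !mxE; exact: rmorphM.
Qed.

Lemma conjC_norm1 (x : C) : `|x| = 1 -> x^* = x^-1.
Proof. by move=> x1; rewrite invC_norm x1 expr1n invr1 mul1r. Qed.

End Adjoint.

Section Unitary.
Local Open Scope sesquilinear_scope.
Variable R : realType.
Local Notation w := (w R).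

Lemma conj_w : w^* = w ^+ 7.
Proof.
have w8 := prim_expr_order (w_prim R).
have w0 : w != 0 by apply: contra_eq_neq w8 => ->; rewrite expr0n eq_sym oner_neq0.
have nw : `|w| = 1 by apply/eqP; rewrite -(@pexpr_eq1 _ _ 8) // -normrX w8 normr1.
by rewrite (conjC_norm1 nw); apply: (mulfI w0); rewrite mulfV // -exprS w8.
Qed.

Lemma monomial_adj N (s : 'I_N -> 'I_N) c : injective s ->
  (monomial R s c)^t* * monomial R s c = 1.
Proof.
move=> s_inj; apply/matrixP => p q; rewrite mulmx_monomial !mxE.
rewrite eq_sym (inj_eq s_inj) eq_sym; case: eqP => [->|]; rewrite ?conjC0 ?mul0r //.
rewrite rmorphXn /= conj_w -exprMn.
by rewrite -exprSr (prim_expr_order (w_prim R)) expr1n.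
Qed.

Let succ8 (j : 'I_8) : 'I_8 := (j : 'Z_8) + 1.

Lemma succ8_inj : injective succ8.
Proof. by move=> i j /addIr. Qed.

Lemma X_monomial : X R = monomial R succ8 (fun=> 0%N).
Proof. by apply/matrixP => p q; rewrite !mxE; case: eqP. Qed.

Lemma Z_monomial : Z R = monomial R id (fun q => q).
Proof. by apply/matrixP => p q; rewrite !mxE; case: eqP => [->|]. Qed.

Lemma X8 : X R ^+ 8 = 1.
Proof.
have XX k : X R ^+ k = monomial R (iter k succ8) (fun=> 0%N).
  elim: k => [|k IHk]; first by rewrite expr0 monomial1.
  by rewrite exprS IHk X_monomial monomialM; apply: eq_monomial.
rewrite XX; apply: monomial1 => // q; apply/val_inj.
by case: q => q; do 8?[case: q => [|q] //].
Qed.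

Lemma Z8 : Z R ^+ 8 = 1.
Proof.
have ZX k : Z R ^+ k = monomial R id (fun q => k * q)%N.
  elim: k => [|k IHk]; first by rewrite expr0 monomial1.
  by rewrite exprS IHk Z_monomial monomialM; apply: eq_monomial => // q; rewrite mulSn.
by rewrite ZX; apply: monomial1 => // q; apply: dvdn_mulr.
Qed.

Lemma ZX : Z R *m X R = w *: (X R *m Z R).
Proof.
rewrite -[_ *m _]/(_ * _) -[X R *m _]/(_ * _) X_monomial Z_monomial !monomialM.
rewrite -[w]expr1 scale_monomial; apply: eq_monomial => // q /=.
by rewrite addn0 modn_mod add0n addnC.
Qed.

Lemma Rmx_YBop m (t : R[i]) : Rmx (Cvec m t) = YBop w m t (X R *t Z R).
Proof. by apply: eq_bigr => k _; rewrite Cvec_exp. Qed.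

Lemma Rhat_unitary m (t : R[i]) : `|t| = 1 -> Rhat m t \is unitarymx.
Proof.
move=> t1.
have t0 : t != 0 by rewrite -normr_eq0 t1 oner_eq0.
(* [Y] is a partner with $VY=wYV$, which places [V] in a quantum torus where [YBop_adj] applies. *)
pose V := X R *t Z R; pose Y : 'M_(8 * 8) := (1%:M : 'M_8) *t X R.
have V8 : V ^+ 8 = 1 by rewrite tensmxX X8 Z8; exact: tensmx1.
have Y8 : Y ^+ 8 = 1 by rewrite tensmxX X8 -[1%:M]/(1) expr1n; exact: tensmx1.
have VY : V * Y = w *: (Y * V).
  rewrite -[V * Y]/(V *m Y) -[Y * V]/(Y *m V) !tensmx_mul mulmx1 mul1mx ZX.
  by apply/matrixP => p q; rewrite !mxE mulrCA.
have adjV : V^t* = V ^+ 7.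
  have : V^t* * V = 1.
    rewrite -[_ * _]/(_ *m _) trmx_tens map_mxT tensmx_mul.
    rewrite X_monomial Z_monomial -[RHS]/(1%:M) -tensmx1; congr (_ *t _);
      apply: monomial_adj => //.
    exact: succ8_inj.
  by move=> VV; rewrite -[LHS]mulr1 -V8 exprS mulrA VV mul1r.
(* Conjugation inverts [w], [t] and [V]; the factor [t] clears the negative power of [t] in the odd
   terms. *)
have adjR : t *: (Rmx (Cvec m t))^t* =
    \sum_(k < 8) (w ^+ (7 * nth 0%N (wexp m) k) * t ^+ (~~ odd k)) *: V ^+ (7 * k).
  rewrite Rmx_YBop /YBop adj_sum scaler_sumr; apply: eq_bigr => k _.
  rewrite adjX adjV -exprM scalerA rmorphM !rmorphXn /= conj_w (conjC_norm1 t1).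
  rewrite -exprM mulrCA; congr (_ * _ *: _).
  by case: (odd k); rewrite /= ?expr1 ?expr0 ?mulr1 ?mulfV.
apply/unitarymxP; have adjZ a (A : 'M[R[i]]_(8 * 8)) : (a *: A)^t* = a^* *: A^t*.
  by apply/matrixP => p q; rewrite !mxE rmorphM.
rewrite /Rhat adjZ -scalemxAl -scalemxAr scalerA.
have := YBop_adj (w_exp4 R) t V8 Y8 VY (ltn_ord m).
rewrite -adjR -Rmx_YBop mulmxZr => /(congr1 (fun A => t^-1 *: A)).
rewrite scalerA mulVf // scale1r => e.
rewrite [_ *m _]e.
rewrite scale_scalar_mx mulrCA mulVf // mulr1 scale_scalar_mx; congr (_%:M).
have s8 : (sqrtC 8 : R[i])^* = sqrtC 8 by apply: conj_Creal; rewrite sqrtC_real ?ler0n.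
rewrite fmorphV /= s8 -invfM -expr2 sqrtCK mulVf // pnatr_eq0 //.
Qed.

End Unitary.

(** * Finiteness of the torsion of H *)

Section Subalgebras.
Variables (F : comUnitRingType) (N : nat).
Implicit Types (G H : set 'M[F]_N) (g a b : 'M[F]_N).

Lemma generated_subalgebraP G : unital_subalgebra (generated_subalgebra G).
Proof.
split; first by move=> A [[A1 _ _] _].
  by move=> c a b Ga Gb A AP; case: (AP) => -[_ AL _] _; apply: AL; [apply: Ga|apply: Gb].
by move=> a b Ga Gb A AP; case: (AP) => -[_ _ AM] _; apply: AM; [apply: Ga|apply: Gb].
Qed.

Lemma centralizer_subalgebra g : unital_subalgebra [set a | a * g = g * a].
Proof.
split=> [|c a b /= ag bg|a b /= ag bg]; first by rewrite /= -[1%:M]/1 mul1r mulr1.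
  by rewrite mulrDl mulrDr mulmxZl mulmxZr ag bg.
by rewrite -[a *m b]/(a * b) -mulrA bg mulrA ag mulrA.
Qed.

Lemma generated_subalgebraC G :
    (forall a b, G a -> G b -> a * b = b * a) ->
  forall a b, generated_subalgebra G a -> generated_subalgebra G b -> a * b = b * a.
Proof.
move=> GC.
suff H a : G a -> forall b, generated_subalgebra G b -> b * a = a * b.
  move=> a b Ga Gb; apply: (smallest_sub (centralizer_subalgebra b) _ Ga).
  by move=> c Gc; exact: esym (H _ Gc _ Gb).
move=> Ga b Gb; apply: (smallest_sub (centralizer_subalgebra a) _ Gb).
by move=> c Gc /=; apply: GC.
Qed.

Lemma transported_subalgebra H g : unital_subalgebra H ->
  unital_subalgebra [set a | exists2 b, H b & g * a = b * g].
Proof.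
move=> [H1 HL HM].
split=> [|c a b /= [a' Ha' ea] [b' Hb' eb]|a b /= [a' Ha' ea] [b' Hb' eb]].
- by exists 1%:M => //; rewrite -[1%:M]/1 mul1r mulr1.
- exists (c *: a' + b'); first exact: HL.
  by rewrite mulrDl mulrDr mulmxZl mulmxZr ea eb.
- exists (a' * b'); first exact: HM.
  by rewrite -[a *m b]/(a * b) mulrA ea -mulrA eb mulrA.
Qed.

Lemma transported_subalgebra_rev H g : unital_subalgebra H ->
  unital_subalgebra [set a | exists2 b, H b & a * g = g * b].
Proof.
move=> [H1 HL HM].
split=> [|c a b /= [a' Ha' ea] [b' Hb' eb]|a b /= [a' Ha' ea] [b' Hb' eb]].
- by exists 1%:M => //; rewrite -[1%:M]/1 mul1r mulr1.
- exists (c *: a' + b'); first exact: HL.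
  by rewrite mulrDl mulrDr mulmxZl mulmxZr ea eb.
- exists (a' * b'); first exact: HM.
  by rewrite -[a *m b]/(a * b) -mulrA eb mulrA ea mulrA.
Qed.

Lemma normalizes_generated G g :
    (forall a, G a -> exists2 b, generated_subalgebra G b & g * a = b * g) ->
    (forall a, G a -> exists2 b, generated_subalgebra G b & a * g = g * b) ->
  normalizes (generated_subalgebra G) g.
Proof.
have GP := generated_subalgebraP G.
move=> g1 g2; split=> a.
  exact: (smallest_sub (transported_subalgebra g GP) g1).
exact: (smallest_sub (transported_subalgebra_rev g GP) g2).
Qed.

Lemma subalgebraZ H c a : unital_subalgebra H -> H a -> H (c *: a).
Proof.
move=> [H1 HL HM] Ha.
have H0 : H 0 by rewrite -(subrr 1%:M) addrC -scaleN1r; apply: HL.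
by rewrite -[_ *: _]addr0; apply: HL.
Qed.

Lemma subalgebraX H a k : unital_subalgebra H -> H a -> H (a ^+ k).
Proof.
move=> [H1 HL HM] Ha; elim: k => [|k IHk]; first by rewrite expr0; exact: H1.
by rewrite exprS; apply: HM.
Qed.

Definition submonoid (A : set 'M[F]_N) : Prop :=
  A 1 /\ forall a b, A a -> A b -> A (a * b).

Lemma smallest_submonoid G : submonoid (smallest submonoid G).
Proof.
split; first by move=> A [[A1 _] _].
by move=> a b Ga Gb A AP; case: (AP) => -[_ AM] _; apply: AM; [apply: Ga|apply: Gb].
Qed.

Lemma transported_submonoid A g : submonoid A ->
  submonoid [set a | exists2 b, A b & g * a = b * g].
Proof.
move=> [A1 AM]; split=> [|a b /= [a' Aa ea] [b' Ab eb]].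
  by exists 1; rewrite ?mul1r ?mulr1.
by exists (a' * b'); [exact: AM | rewrite mulrA ea -mulrA eb mulrA].
Qed.

(** Conjugation by [g] maps a finite set injectively into itself, hence onto itself. *)
Lemma transports_finite (s : seq 'M[F]_N) g : g \in unitmx ->
  transports [set` s] g -> normalizes [set` s] g.
Proof.
move=> gU gs; split=> //.
have gK : invmx g * g = 1 by exact: mulVmx.
have Kg : g * invmx g = 1 by exact: mulmxV.
pose f a := g * a * invmx g.
have fs : {subset map f (undup s) <= undup s}.
  move=> _ /mapP[a + ->]; rewrite !mem_undup => /gs[b bs gab].
  by rewrite /f gab -mulrA Kg mulr1.
have f_inj : injective f.
  by move=> a b ab; rewrite -[a]mul1r -[b]mul1r -gK -[_ * a]mulr1 -[_ * b]mulr1 -gK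
    !mulrA -!(mulrA (invmx g)) -/(f a) -/(f b) ab.
have f_uniq : uniq (map f (undup s)) by rewrite map_inj_uniq // undup_uniq.
have [|_ eq_s] := uniq_min_size f_uniq fs; first by rewrite size_map.
move=> a /=; rewrite -mem_undup -eq_s => /mapP[b + ->]; rewrite mem_undup => bs.
by exists b => //; rewrite /f -!mulrA gK mulr1.
Qed.

End Subalgebras.

Section Involutions.
Variables (C : numClosedFieldType) (N : nat) (z : C).
Hypothesis z8 : 8.-primitive_root z.

Lemma involution_diagonalizable (A : 'M[C]_N) : A * A = 1 -> diagonalizable A.
Proof.
case: N A => [|M] A AA; first by rewrite thinmx0; apply: diagonalizable0.
apply/diagonalizableP; exists [:: 1; -1].
  by rewrite /= inE -addr_eq0 -(natrD _ 1 1) pnatr_eq0.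
apply: mxminpoly_min; rewrite !big_cons big_nil mulr1 rmorphM /= !rmorphB /=.
rewrite horner_mx_X !horner_mx_C raddfN opprK -[1%:M]/1.
by rewrite mulrDr mulr1 mulrBl mul1r AA addrC subrKA subrr.
Qed.

(** Commuting involutions are diagonal in a common basis, and so is the algebra they generate; there
    $h^8=1$ leaves eight choices for each diagonal entry. *)
Lemma finite_torsion (I : finType) (J : I -> 'M[C]_N) :
    (forall i, J i * J i = 1) -> (forall i j, J i * J j = J j * J i) ->
  finite_set [set h | generated_subalgebra (range J) h /\ h ^+ 8 = 1].
Proof.
move=> JJ JC.
have [P Pu /allP /= PJ] : codiagonalizable [seq J i | i <- enum I].
  apply/codiagonalizableP; split=> [_ _ /mapP[i _ ->] /mapP[j _ ->]|_ /mapP[i _ ->]].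
    exact: JC.
  exact: involution_diagonalizable.
have PK : invmx P * P = 1 by exact: mulVmx.
have KP : P * invmx P = 1 by exact: mulmxV.
pose D := [set h : 'M[C]_N | exists d, P * h = diag_mx d * P].
have DJ i : D (J i).
  have /diagonalizable_forPex[d /(simmxP Pu) e] : diagonalizable_for P (J i).
    by apply: PJ; apply: map_f; rewrite mem_enum.
  by exists d.
have Dsub : unital_subalgebra D.
  split=> [|c a b [d ad] [e be]|a b [d ad] [e be]].
  - by exists (const_mx 1); rewrite diag_const_mx -[1%:M]/1 mulr1 mul1r.
  - exists (c *: d + e).
    by rewrite mulrDr mulmxZr ad be linearD linearZ mulrDl mulmxZl.
  - exists (\row_i (d 0 i * e 0 i)).
    by rewrite -[a *m b]/(a * b) mulrA ad -mulrA be mulrA -mulmx_diag.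
pose f (c : {ffun 'I_N -> 'I_8}) := invmx P * diag_mx (\row_i z ^+ c i) * P.
apply: sub_finite_set (finite_image f (@finite_finset _ setT)) => h [Hh h8].
have [d hd] : D h by apply: (smallest_sub Dsub) Hh => _ [i _ <-].
have d8 i : exists k : 'I_8, d 0 i = z ^+ k.
  suff e : d 0 i ^+ 8 = 1 by have [k ->] := prim_rootP z8 e; exists k.
  have dX k : P * h ^+ k = diag_mx (\row_j d 0 j ^+ k) * P.
    elim: k => [|k IHk].
      rewrite expr0 mulr1 [X in diag_mx X](_ : _ = const_mx 1) ?diag_const_mx ?mul1r //.
      by apply/rowP => j; rewrite !mxE.
    rewrite exprS mulrA hd -mulrA IHk mulrA -[_ * diag_mx _]/(_ *m _) mulmx_diag.
    by congr (diag_mx _ * _); apply/rowP => j; rewrite !mxE exprS.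
  have : diag_mx (\row_j d 0 j ^+ 8) = 1.
    by rewrite -[LHS]mulr1 -KP mulrA -dX h8 mulr1 KP.
  by move/matrixP/(_ i i); rewrite !mxE eqxx.
exists [ffun i => projT1 (cid (d8 i))] => //; rewrite /f.
rewrite [X in diag_mx X](_ : _ = d) -?mulrA -?hd ?mulrA ?PK ?mul1r //.
by apply/rowP => i; rewrite mxE ffunE; case: cid.
Qed.

End Involutions.

(** * The image of the braid group *)

Section YangBaxterGroup.
Variables (R : realType) (n : nat).
Local Notation C := R[i].
Local Notation w := (w R).
Local Notation Xop := (@tensor_X R n).
Local Notation Zop := (@tensor_Z R n).
Local Notation H := (Hmat R n).
Local Notation J := (@J R n).
Implicit Types (k l : 'I_n.-1) (i j : 'I_n).

Definition lo k : 'I_n := Ordinal (ltnW (ltn_ord_pred k)).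
Definition hi k : 'I_n := Ordinal (ltn_ord_pred k).
Definition uop k : 'M[C]_(8 ^ n) := Xop (lo k) * Zop (hi k).

Lemma JE k : J k = uop k ^+ 4.
Proof.
rewrite /Defs.J /uop /tensor_X /tensor_Z.
rewrite (bool_irrelevance (ltn_ord (lo k)) (ltnW (ltn_ord_pred k))).
by rewrite (bool_irrelevance (ltn_ord (hi k)) (ltn_ord_pred k)).
Qed.

Lemma on_pair_uop k : on_pair (ltn_ord_pred k) (X R *t Z R) = uop k.
Proof. exact: on_pair_XZ. Qed.

Lemma uop_X k j : wcomm (hi k == j) (uop k) (Xop j).
Proof.
by rewrite -[nat_of_bool _]add0n; apply: wcommMl; [apply/wcomm0/XopC|apply: ZXop].
Qed.

Lemma uop_Z k j : wcomm (7 * (lo k == j)) (uop k) (Zop j).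
Proof.
by rewrite -[(7 * _)%N]addn0; apply: wcommMl; [apply: XZop|apply/wcomm0/ZopC].
Qed.

Lemma uop_uop k l : wcomm ((hi k == lo l) + 7 * (lo k == hi l)) (uop k) (uop l).
Proof. by apply: wcommMr; [apply: uop_X | apply: uop_Z]. Qed.

Lemma uop8 k : uop k ^+ 8 = 1.
Proof.
have XZ : GRing.comm (Xop (lo k)) (Zop (hi k)).
  apply/wcomm0; have := XZop R (lo k) (hi k).
  by have /negPf -> : lo k != hi k by rewrite -val_eqE /= ltn_eqF.
by rewrite /uop (exprMn_comm 8 XZ) (Xop8 R (lo k)) (Zop8 R (hi k)) mulr1.
Qed.

Lemma uopXhi k : uop k * Xop (hi k) = w *: (Xop (hi k) * uop k).
Proof. by have := uop_X k (hi k); rewrite eqxx /wcomm expr1. Qed.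

Lemma Zlouop k : Zop (lo k) * uop k = w *: (uop k * Zop (lo k)).
Proof.
have := uop_Z k (lo k); rewrite eqxx muln1.
by move=> /(@wcomm_sym _ _ 7 1 _ _ erefl); rewrite /wcomm expr1.
Qed.

Lemma uop_succ k l : l = k.+1 :> nat -> uop k * uop l = w *: (uop l * uop k).
Proof.
by move=> lk; have := uop_uop k l; rewrite -!val_eqE /= lk eqxx ltn_eqF.
Qed.

Lemma uop_far k l : l != k.+1 :> nat -> k != l.+1 :> nat -> uop k * uop l = uop l * uop k.
Proof.
move=> lk kl; apply/wcomm0; have := uop_uop k l.
by rewrite -!val_eqE /= eq_sym (negPf lk) (negPf kl).
Qed.

Lemma JJ k : J k * J k = 1.
Proof. by rewrite JE -exprD uop8. Qed.

Lemma J_wcomm k c A : wcomm c (uop k) A -> J k * A = (-1) ^+ c *: (A * J k).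
Proof.
by rewrite JE => /(wcommX 4); rewrite /wcomm (mulnC c 4) (exprM w 4 c) w_exp4.
Qed.

(* Keeps failed unifications from unfolding operators into their entries. *)
#[local] Opaque uop tensor_X tensor_Z YBop Defs.J.

(** Fourth powers on both sides multiply the exponent of [w] by 16. *)
Lemma JC k l : J k * J l = J l * J k.
Proof.
have := wcommXr 4 (wcommX 4 (uop_uop k l)); rewrite -!JE -wcomm8.
by rewrite -mulnA -modnMmr muln0 mod0n => /wcomm0.
Qed.

Lemma H_sub : unital_subalgebra H. Proof. exact: generated_subalgebraP. Qed.

Lemma HJ k : H (J k).
Proof. by apply: sub_gen_smallest; exists k. Qed.

Lemma wcomm_normalizes A : (forall k, exists c, wcomm c (uop k) A) -> normalizes H A.
Proof.
move=> cA; apply: normalizes_generated => _ [k _ <-]; have [c /J_wcomm JA] := cA k.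
  exists ((-1) ^+ c *: J k); first by apply: subalgebraZ H_sub (HJ k).
  by rewrite mulmxZl JA scalerA -expr2 sqrr_sign scale1r.
exists ((-1) ^+ c *: J k); first by apply: subalgebraZ H_sub (HJ k).
by rewrite mulmxZr JA.
Qed.

Lemma Xop_normalizes j : normalizes H (Xop j).
Proof. by apply: wcomm_normalizes => k; exists (hi k == j); apply: uop_X. Qed.

Lemma Zop_normalizes j : normalizes H (Zop j).
Proof. by apply: wcomm_normalizes => k; exists (7 * (lo k == j))%N; apply: uop_Z. Qed.

Section Generator.
Variables (m : nat) (t : C).
Hypothesis m8 : (m < 8)%N.
Local Notation Y := (YBop w m t).

Lemma YBop_J k l : exists (s : bool) (e : bool),
  Y (uop k) * J l = (-1) ^+ s *: (J l * J k ^+ e) * Y (uop k).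
Proof.
have [lk|lk] := eqVneq (val l) k.+1.
  have [s e] := YBop_J_u (w_exp4 R) t (uop8 k) (uop8 l) (uop_succ lk) m8.
  by exists s, true; rewrite expr1 !JE.
have [kl|kl] := eqVneq (val k) l.+1.
  have [s e] := YBop_J_v (w_exp4 R) t (uop8 l) (uop8 k) (uop_succ kl) m8.
  by exists s, true; rewrite expr1 (JC l k) !JE.
(* In the remaining cases, [l = k] included, [uop k] and [uop l] commute. *)
exists false, false; rewrite !expr0 scale1r mulr1; apply/esym/YBop_comm.
by rewrite JE; apply/esym/commrX; exact: uop_far.
Qed.

(** By [YBop_J] it suffices to treat the generators [J l]. As [J k] commutes with the operator and
    squares to 1, the same element $\pm J_lJ_k^e$ serves in both directions. *)
Lemma YBop_normalizes k : normalizes H (Y (uop k)).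
Proof.
have [H1 HL HM] := H_sub.
have YJk : J k * Y (uop k) = Y (uop k) * J k.
  by apply: YBop_comm; rewrite JE -exprS -exprSr.
have HJe l (s e : bool) : H ((-1) ^+ s *: (J l * J k ^+ e)).
  by apply: subalgebraZ H_sub _; apply: HM (HJ l) _; apply: subalgebraX H_sub (HJ k).
apply: normalizes_generated => _ [l _ <-]; have [s [e YJ]] := YBop_J k l.
  by exists ((-1) ^+ s *: (J l * J k ^+ e)); [exact: HJe | exact: YJ].
exists ((-1) ^+ s *: (J l * J k ^+ e)); first exact: HJe.
have JJe : J k ^+ e * J k ^+ e = 1 by case: (e); rewrite ?expr1 ?JJ // expr0 mulr1.
have YJe : J k ^+ e * Y (uop k) = Y (uop k) * J k ^+ e.
  by case: (e); rewrite ?expr1 ?expr0 ?mul1r ?mulr1.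
rewrite mulmxZr mulrA YJ mulmxZl mulmxZl scalerA -expr2 sqrr_sign scale1r.
have swap (K : pzRingType) (a b y : K) :
    b * b = 1 -> b * y = y * b -> a * y = a * b * y * b.
  by move=> bb yb; rewrite -!mulrA -yb (mulrA b b) bb mul1r.
exact: swap JJe YJe.
Qed.

Lemma YBop_unit k : t != 0 -> Y (uop k) \in unitmx.
Proof.
move=> t0; have e := YBop_adj (w_exp4 R) t (uop8 k) (Xop8 R (hi k)) (uopXhi k) m8.
have t8 : 8 * t != 0 by rewrite mulf_neq0 // pnatr_eq0.
have : Y (uop k) *m ((8 * t)^-1 *: \sum_(k0 < 8) (w ^+ (7 * nth 0%N (wexp m) k0) *
    t ^+ (~~ odd k0)) *: uop k ^+ (7 * k0)) = 1%:M.
  by rewrite -scalemxAr [_ *m _]e scale_scalar_mx mulVf.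
by case/mulmx1_unit.
Qed.

End Generator.

End YangBaxterGroup.

#[local] Opaque uop tensor_X tensor_Z YBop Defs.J.

(** * A finite monoid preserved by the generators at [t = 1] *)

Section CliffordSet.
Variables (R : realType) (n : nat).
Local Notation C := R[i].
Local Notation w := (w R).
Local Notation Xop := (@tensor_X R n).
Local Notation Zop := (@tensor_Z R n).
Local Notation H := (Hmat R n).
Local Notation J := (@J R n).
Local Notation uop := (@uop R n).
Implicit Types (k l : 'I_n.-1) (i j : 'I_n).

Definition torsion : set 'M[C]_(8 ^ n) := [set h | H h /\ h ^+ 8 = 1].

(** The torsion of [H] is included to absorb the [hpart] factors of [YBop_conj_u] and
    [YBop_conj_v]. *)
Definition clifford : set 'M[C]_(8 ^ n) :=
  smallest (@submonoid C (8 ^ n)) (range Xop `|` range Zop `|` torsion).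

Lemma HC a b : H a -> H b -> a * b = b * a.
Proof.
apply: generated_subalgebraC => _ _ [k _ <-] [l _ <-]; exact: JC.
Qed.

Lemma clifford_monoid : submonoid clifford.
Proof. exact: smallest_submonoid. Qed.

Lemma clifford_X j : clifford (Xop j).
Proof. by apply: sub_gen_smallest; left; left; exists j. Qed.

Lemma clifford_Z j : clifford (Zop j).
Proof. by apply: sub_gen_smallest; left; right; exists j. Qed.

Lemma clifford_torsion h : torsion h -> clifford h.
Proof. by move=> Th; apply: sub_gen_smallest; right. Qed.

Lemma unit_exp8 (A : 'M[C]_(8 ^ n)) : A ^+ 8 = 1 -> A \in unitmx.
Proof. by rewrite exprS => /mulmx1_unit[]. Qed.

Lemma torsion_transport (p h h' : 'M[C]_(8 ^ n)) : p \in unitmx ->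
  h ^+ 8 = 1 -> h * p = p * h' -> h' ^+ 8 = 1.
Proof.
move=> pU h8 hp.
have hpX e : h ^+ e * p = p * h' ^+ e.
  elim: e => [|e IHe]; first by rewrite !expr0 mulr1 mul1r.
  by rewrite exprSr -mulrA hp mulrA IHe -mulrA exprSr.
have pK : invmx p * p = 1 by exact: mulVmx.
by rewrite -[LHS]mul1r -pK -mulrA -(hpX 8) h8 mul1r.
Qed.

Lemma torsion_transport_rev (p h h' : 'M[C]_(8 ^ n)) : p \in unitmx ->
  h ^+ 8 = 1 -> p * h = h' * p -> h' ^+ 8 = 1.
Proof.
move=> pU h8 ph; apply: (torsion_transport (p := invmx p) _ h8); rewrite ?unitmx_inv //.
have pK : invmx p * p = 1 by exact: mulVmx.
have Kp : p * invmx p = 1 by exact: mulmxV.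
by rewrite -[h]mul1r -pK -(mulrA _ p) ph -!mulrA Kp mulr1.
Qed.

(** Every element is $ph$ with [p] monomial, invertible and normalizing [H], and [h] torsion: in a
    product, a torsion element moves right past the next monomial factor and stays torsion in
    [H]. *)
Lemma finite_clifford : finite_set clifford.
Proof.
have [H1 HL HM] := H_sub R n.
pose P := [set p : 'M[C]_(8 ^ n) | [/\ is_monomial p, p \in unitmx & normalizes H p]].
suff sub : clifford `<=` [set p * h | p in P & h in torsion].
  apply: sub_finite_set sub _; apply: finite_image2.
    by apply: sub_finite_set (finite_monomial R (8 ^ n)) => p [].
  apply: (finite_torsion (w_prim R)) => [k|k l]; [exact: JJ | exact: JC].
have P1 : P 1.
  split; [|exact: unitmx1|exact: normalizes1].
  by exists id, (fun=> 0%N); rewrite monomial1.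
have T1 : torsion 1 by split; [exact: H1|rewrite expr1n].
apply: smallest_sub; first split.
- by exists 1 => //; exists 1; rewrite // mulr1.
- move=> _ _ [p [[s [c pE]] pU pN] [h [Hh h8] <-]]
    [q [[s' [c' qE]] qU qN] [h' [Hh' h8'] <-]].
  have [h2 Hh2 e] := qN.2 _ Hh.
  exists (p * q).
    split; [|by rewrite unitmx_mul pU|exact: normalizesM].
    by rewrite pE qE monomialM; do 2 eexists.
  exists (h2 * h'); last by rewrite -!mulrA; congr (p * _); rewrite !mulrA e.
  split; first exact: HM.
  by rewrite exprMn_comm ?(torsion_transport qU h8 e) ?h8' ?mulr1 //; apply: HC.
- move=> a [[[j _ <-]|[j _ <-]]|Ta].
  + exists (Xop j); last by exists 1; rewrite // mulr1.
    split; [by rewrite XopE; do 2 eexists | | exact: Xop_normalizes].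
    exact/unit_exp8/Xop8.
  + exists (Zop j); last by exists 1; rewrite // mulr1.
    split; [by rewrite ZopE; do 2 eexists | | exact: Zop_normalizes].
    exact/unit_exp8/Zop8.
  + by exists 1 => //; exists a; rewrite // mul1r.
Qed.

Lemma hpart_H a b k : H (hpart a b (J k)).
Proof.
have [H1 HL HM] := H_sub R n; apply: subalgebraZ (H_sub R n) _.
by apply: HL; [exact: H1 | exact: subalgebraZ (H_sub R n) (HJ k)].
Qed.

Lemma hpart_torsion p q k : torsion (hpart (w ^+ p) (w ^+ q) (J k)).
Proof.
split; first exact: hpart_H.
rewrite hpartX ?JJ // -!exprM !(mulnC _ 8) !exprM (prim_expr_order (w_prim R)).
by rewrite !expr1n hpart1.
Qed.

(** Generators suffice. Among the [Xop j] and [Zop j], only [Xop (hi k)] and [Zop (lo k)] fail to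
    commute with [uop k]; torsion goes to torsion because [H] is normalized. *)
Lemma YBop_clifford m k : (m < 8)%N -> transports clifford (YBop w m 1 (uop k)).
Proof.
move=> m8; set Y := YBop w m 1 (uop k).
have [_ SM] := clifford_monoid.
have SX a e : clifford a -> clifford (a ^+ e).
  move=> Sa; elim: e => [|e IHe]; first by rewrite expr0; case: clifford_monoid.
  by rewrite exprS; apply: SM.
have Su : clifford (uop k) by apply: SM; [exact: clifford_X | exact: clifford_Z].
suff sub : clifford `<=` [set a | exists2 b, clifford b & Y * a = b * Y] by [].
apply: smallest_sub; first exact: transported_submonoid _ clifford_monoid.
move=> a [[[j _ <-]|[j _ <-]]|[Ha a8]] /=.
- have [<-|jk] := eqVneq (hi k) j.
    have [r [p [q e]]] :=
      YBop_conj_u (w_exp4 R) 1 (uop8 R k) (Xop8 R (hi k)) (uopXhi R k) m8.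
    eexists; last exact: e.
    apply: (SM _ _ (SM _ _ (clifford_X _) (SX _ _ Su))).
    by rewrite -JE; exact: clifford_torsion (hpart_torsion p q k).
  exists (Xop j); first exact: clifford_X.
  apply/esym/YBop_comm/esym/wcomm0; have := uop_X R k j.
  by rewrite (negPf jk).
- have [<-|jk] := eqVneq (lo k) j.
    (* Since $Z_ku_k=wu_kZ_k$, [uop k] now takes the place of [v] in the torus. *)
    have [r [p [q e]]] :=
      YBop_conj_v (w_exp4 R) 1 (Zop8 R (lo k)) (uop8 R k) (Zlouop R k) m8.
    eexists; last exact: e.
    apply: (SM _ _ (SM _ _ (clifford_Z _) (SX _ _ Su))).
    by rewrite -JE; exact: clifford_torsion (hpart_torsion p q k).
  exists (Zop j); first exact: clifford_Z.
  apply/esym/YBop_comm/esym/wcomm0; have := uop_Z R k j.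
  by rewrite (negPf jk).
- have [b Hb e] := (YBop_normalizes 1 m8 k).1 _ Ha.
  exists b; last exact: e.
  apply: clifford_torsion; split; first exact: Hb.
  have YU : Y \in unitmx by apply: YBop_unit; rewrite ?oner_eq0.
  exact: torsion_transport_rev YU a8 e.
Qed.

End CliffordSet.

Lemma unitmx_right_inverse (K : comUnitRingType) N (A B : 'M[K]_N) :
  A * B = 1 -> A \in unitmx.
Proof. by case/mulmx1_unit. Qed.

Lemma scale_comm (K : comPzRingType) N (c : K) (A B : 'M[K]_N) :
  A * B = B * A -> (c *: A) * (c *: B) = (c *: B) * (c *: A).
Proof. by move=> AB; rewrite !mulmxZl !mulmxZr AB. Qed.

Lemma scale_braid (K : comPzRingType) N (c : K) (A B : 'M[K]_N) :
  A * B * A = B * A * B ->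
  (c *: A) * (c *: B) * (c *: A) = (c *: B) * (c *: A) * (c *: B).
Proof. by move=> AB; rewrite !mulmxZl !mulmxZr !mulmxZl AB. Qed.

(** * The representation and the structure of its image *)

Section Representation.
Variables (R : realType) (n : nat) (m : 'I_8) (t c : R[i]).
Hypotheses (t0 : t != 0) (c0 : c != 0).
Local Notation C := R[i].
Local Notation w := (w R).
Local Notation H := (Hmat R n).
Local Notation uop := (@uop R n).
Local Notation J := (@J R n).
Local Notation GL := (glmx C (8 ^ n)).

Lemma gen_subproof k : c *: YBop w m t (uop k) \in unitmx.
Proof. by rewrite unitmxZ ?unitfE // YBop_unit. Qed.

Definition gen k : GL := Sub (c *: YBop w m t (uop k)) (gen_subproof k).

Lemma gen_yb (k l : 'I_n.-1) : l = k.+1 :> nat ->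
  (gen k * gen l * gen k = gen l * gen k * gen l)%g.
Proof.
move=> lk; apply: val_inj.
have e := YBop_braid (w_exp4 R) t (uop8 R k) (uop8 R l) (uop_succ R lk) (ltn_ord m).
refine (scale_braid c e).
Qed.

Lemma gen_far (k l : 'I_n.-1) : (k.+1 < l)%N -> (gen k * gen l = gen l * gen k)%g.
Proof.
move=> kl; apply: val_inj.
apply: (@scale_comm _ _ c (YBop w m t (uop k)) (YBop w m t (uop l))).
apply/YBop_comm/esym/YBop_comm; apply: uop_far; lia.
Qed.

Lemma gen_val k : val (gen k) = on_pair (ltn_ord_pred k) (c *: Rmx (Cvec m t)).
Proof.
rewrite on_pairZ Rmx_YBop YBopE on_pair_sum -[LHS]/(c *: YBop w m t (uop k)) YBopE.
congr (_ *: _); apply: eq_bigr => j _.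
by rewrite on_pairX on_pair_uop.
Qed.

Definition affine : set GL := [set g : GL | exists s : GL * GL,
  [/\ normalizes H (val s.1), normalizes (@clifford R n) (val s.1),
      subalgebra_units H s.2 & g = (s.1 * s.2)%g]].

(** $(ah)(bh')=ab\,(b^{-1}hb)h'$, and [b] normalizes [H]. *)
Lemma affine_subgroup : subgroup affine.
Proof.
have [U1 UM UV] := subgroup_units (H_sub R n).
have aV (A : set 'M_(8 ^ n)) (a : GL) :
    normalizes A (val a) -> normalizes A (val (a^-1 : GL)%g).
  by apply: normalizesV; [exact: mulmxV (valP a) | exact: mulVmx (valP a)].
split.
- by exists (1, 1)%g; rewrite mulg1; split=> //; exact: normalizes1.
- move=> _ _ [[a h] /= [aH aS hH ->]] [[b h'] /= [bH bS hH' ->]].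
  exists (a * b, (b^-1 * h * b) * h')%g => /=; split.
  + exact: normalizesM.
  + exact: normalizesM.
  + apply: (UM) => //; rewrite -{2}[b]invgK.
    by apply: units_conj => //; exact: aV.
  + by rewrite !mulgA mulgK.
- move=> _ [[a h] /= [aH aS hH ->]].
  exists (a^-1, a * h^-1 * a^-1)%g => /=.
  split; [exact: aV | exact: aV | | by rewrite invgM !mulgA mulVg mul1g].
  by apply: units_conj => //; apply: UV.
Qed.

(** The scalar [c] and the factor carrying [t] go into the unit of [H]. The operator at [t = 1]
    remains, and finiteness of [clifford] turns transport into normalization. *)
Lemma gen_affine k : affine (gen k).
Proof.
pose Y := YBop w m 1 (uop k).
have YU : Y \in unitmx by apply: YBop_unit; rewrite ?oner_eq0.
have [a [b [a0 b0 Yt]]] : exists a b, [/\ a != 0, b != 0 &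
    YBop w m t (uop k) = hpart a b (J k) * Y].
  have := YBop_split (w_exp4 R) t (uop8 R k) (Xop8 R (hi k)) (uopXhi R k) (ltn_ord m).
  rewrite -JE; case: ifP => _ ->; [exists t, 1 | exists 1, t];
    by split; rewrite ?oner_eq0.
have HS := H_sub R n.
have hV : hpart a b (J k) * hpart a^-1 b^-1 (J k) = 1.
  by rewrite hpartM ?JJ // !mulfV // hpart1.
have chV : (c *: hpart a b (J k)) * (c^-1 *: hpart a^-1 b^-1 (J k)) = 1.
  by rewrite mulmxZl mulmxZr hV scalerA mulfV // scale1r.
have hU : c *: hpart a b (J k) \in unitmx by exact: unitmx_right_inverse chV.
exists (Sub Y YU, Sub (c *: hpart a b (J k)) hU) => /=; split.
- exact: YBop_normalizes.
- have [s sE] := (finite_seqP _).1 (finite_clifford R n).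
  by rewrite sE; apply: transports_finite YU _; rewrite -sE; apply: YBop_clifford.
- split; first by apply: subalgebraZ HS _; exact: hpart_H.
  rewrite -[val _]/(invmx (c *: hpart a b (J k))) -[invmx _]mulmx1.
  rewrite -[1%:M]/1 -chV -[_ * _]/(_ *m _) mulKmx //.
  by apply: subalgebraZ HS _; exact: hpart_H.
- apply: val_inj; rewrite -[RHS]/(Y * (c *: hpart a b (J k))) mulmxZr.
  rewrite -[LHS]/(c *: YBop w m t (uop k)) Yt; congr (_ *: _).
  have JY : J k * Y = Y * J k by apply: YBop_comm; rewrite JE -exprS -exprSr.
  by rewrite /hpart mulmxZl mulmxZr mulrDl mulrDr !mulmxZl !mulmxZr mul1r mulr1 JY.
Qed.

(** The scalar [c] treats both normalizations at once: $1/\sqrt8$ for [Rhat] and 1 for the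
    unnormalized operator. *)
Lemma virtually_abelian_rep (A : 'M[C]_(8 * 8)) : A = c *: Rmx (Cvec m t) ->
  exists rho : {multiplicative braid n -> GL},
    let Gamma := range rho in
    let A' := Gamma `&` subalgebra_units H in
    [/\ is_rep_generated_by A rho, virtually_abelian Gamma,
        abelian_set A', normal_in A' Gamma & finite_index_in A' Gamma].
Proof.
move=> ->; have [rho [rhoE rho_sub]] := braid_rep_exists gen_yb gen_far.
exists rho => Gamma A'.
have Gdec : Gamma `<=` affine.
  by apply: rho_sub; [exact: affine_subgroup | exact: gen_affine].
have [s sE] := (finite_seqP _).1 (finite_clifford R n).
have Gsub : subgroup Gamma := subgroup_range rho.
pose x (i : 'I_n + 'I_n) := match i with inl j => tensor_X R j | inr j => tensor_Z R j end.
have sx i : x i \in s.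
  suff : [set` s] (x i) by [].
  by rewrite -sE; case: i => j; [exact: clifford_X | exact: clifford_Z].
have x_cent M : (forall i, M * x i = x i * M) -> exists d, M = d%:M.
  move=> Mx; apply: Pauli_centralizer => j; first exact: (Mx (inl j)).
  exact: (Mx (inr j)).
have Gdec' g : Gamma g -> exists r, factorization H s g r.
  by move=> /Gdec[r [r1 [r2 _] r3 r4]]; exists r; split=> //; rewrite -sE.
have HS := H_sub R n.
split.
- by move=> k; rewrite rhoE gen_val.
- exact: virtually_abelian_extension HS (@HC R n) sx x_cent Gsub Gdec'.
- exact: abelian_unit_part (@HC R n).
- exact: normal_unit_part HS Gsub Gdec'.
- exact: finite_index_unit_part HS sx x_cent Gsub Gdec'.
Qed.

End Representation.

Unset Implicit Arguments.
Set Strict Implicit.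
Set Printing Implicit Defensive.

Theorem theorem9p3 (R : realType) (n : nat) (t : R[i]) (m : 'I_8)
    (hn : (2 <= n)%N) (ht : t != 0) :
  [/\ exists rho : {multiplicative braid n -> glmx R[i] (8 ^ n)},
        let Gamma := range rho in
        let A := Gamma `&` subalgebra_units (Hmat R n) in
        [/\ is_rep_generated_by (Rhat m t) rho,
            virtually_abelian Gamma,
            abelian_set A, normal_in A Gamma & finite_index_in A Gamma],
      exists rho : {multiplicative braid n -> glmx R[i] (8 ^ n)},
        let Gamma := range rho in
        let A := Gamma `&` subalgebra_units (Hmat R n) in
        [/\ is_rep_generated_by (Rmx (Cvec m t)) rho,
            virtually_abelian Gamma,
            abelian_set A, normal_in A Gamma & finite_index_in A Gamma]
    & `|t| = 1 -> Rhat m t \is unitarymx].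
Proof.
split.
- have c0 : (sqrtC 8 : R[i])^-1 != 0 by rewrite invr_eq0 sqrtC_eq0 pnatr_eq0.
  exact: (virtually_abelian_rep n ht c0 (erefl (Rhat m t))).
- have e : Rmx (Cvec m t) = 1 *: Rmx (Cvec m t) by rewrite scale1r.
  exact: (virtually_abelian_rep n ht (oner_neq0 _) e).
- exact: Rhat_unitary.
Qed.
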